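(* Let $G(\Delta)\in\mathcal G_2$ (partial gain-scheduling plant class) and $\gamma>0$ be given. The following two statements are equivalent. (i) There exist a structured controller $K(\Delta)\in\mathcal K_2$ with $r^c=s^c=:l^c$, symmetric $\mathcal X_1\succ0$ and $\mathcal P\in\mathbf P$ such that the closed-loop matrices of the lifted plant with $K(\Delta)$ satisfy $$\mathcal N^T\mathrm{diag}\!\left(\begin{pmatrix}0&\mathcal X_1\\ \mathcal X_1&0\end{pmatrix},\begin{pmatrix}0&\mathcal P\\ \mathcal P&0\end{pmatrix},\begin{pmatrix}-\gamma I&0\\0&I\end{pmatrix}\right)\mathcal N\prec0,\qquad \mathcal N=\begin{pmatrix}I&0&0\\ \mathcal A_{11}&\mathcal A_{12}&\mathcal B_1\\0&I&0\\ \mathcal A_{21}&\mathcal A_{22}&\mathcal B_2\\0&0&I\\ \mathcal C_1&\mathcal C_2&\mathcal D\end{pmatrix}.\tag{1}$$ (ii) There exist Lyapunov variables $(S_3,T_1,S_{22},T_{22},W)$, multiplier variables $X_2\in\mathbf P_p$, $Y_2\in\mathbf P_d$, and controller variables $\mathsf K_{ij},\mathsf L_i,\mathsf M_j,\mathsf N$ ($i,j=1,2$), all as described in the context, such that $$\mathbb N^T\mathrm{diag}\!\left(\begin{pmatrix}0&I\\ I&0\end{pmatrix},\begin{pmatrix}0&I\\ I&0\end{pmatrix},\begin{pmatrix}-\gamma I&0\\0&I\end{pmatrix}\right)\mathbb N\prec0,\qquad \mathbb N=\begin{pmatrix}I&0&0\\ \mathbb A_{11}&\mathbb A_{12}&\mathbb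 B_1\\0&I&0\\ \mathbb A_{21}&\mathbb A_{22}&\mathbb B_2\\0&0&I\\ \mathbb C_1&\mathbb C_2&\mathbb D\end{pmatrix},\qquad \mathbb X\succ0,$$ where, for $i,j=1,2$, $$\begin{pmatrix}\mathbb A_{ij}&\mathbb B_i\\ \mathbb C_j&\mathbb D\end{pmatrix}:=\begin{pmatrix}A_{ij}Y_j&A_{ij}&B_i^p\\0&X_i^TA_{ij}&X_i^TB_i^p\\ C_j^pY_j&C_j^p&D^p\end{pmatrix}+\begin{pmatrix}0&B_i\\ I&0\\0&E\end{pmatrix}\begin{pmatrix}K_{ij}&L_i\\ M_j&N\end{pmatrix}\begin{pmatrix}I&0&0\\0&C_j&F\end{pmatrix}$$ with $N:=\mathsf N$, $$L_1:=\mathsf L_1+\mathscr U(B_1^e\mathsf N),\qquad M_1:=\mathsf M_1+\mathscr U(\mathsf NC_1^e),$$ $$K_{11}:=\mathsf K_{11}+\mathscr U(X_1^TA_{11}Y_1)+\mathscr U(B_1^e\mathsf M_1)+\mathscr U(\mathsf L_1C_1^e)-B_1^e\mathsf NC_1^e,$$ $$L_2:=\mathsf L_2,\quad M_2:=\mathsf M_2,\quad K_{12}:=\mathsf K_{12},\quad K_{22}:=\mathsf K_{22},$$ $$K_{21}:=\mathsf K_{21}+\mathscr R(X_2^TA_{21}Y_1)+\mathscr R(\mathsf L_2C_1^e).$$ Moreover, if the conditions in (ii) are satisfied, then there exist $\mathcal X_1\succ0$, $\mathcal P\in\mathbf P$ and $K(\Delta)\in\mathcal K_2$ with an affine scheduling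 function $\hat\Delta_c(\cdot)$ such that (1) holds, where the sizes of $\hat A^c_{11}$ and $\hat A^c_{22}$ are bounded by $2|n|\times2|n|$ and $|l|\times|l|$, respectively.
   Context: All matrices are real. $\prec 0$/$\succ0$ mean negative/positive definite for symmetric matrices. For a tuple $a$ of nonnegative integers, $|a|$ is the sum of its entries; $a\times b$ matrices are $|a|\times|b|$ matrices with induced block partition. $\mathbf V=\mathrm{Co}\{\Delta_1,\dots,\Delta_N\}\subset\mathbb R^{r_\Delta\times s_\Delta}$ is the convex hull of finitely many matrices, with $0\in\mathbf V$. For $a,b\in\mathbb N_0^2$, an $a\times b$ matrix is lower block triangular if it has the form $\begin{pmatrix}J_{11}&0\\ J_{21}&J_{22}\end{pmatrix}$, $J_{\mu\nu}\in\mathbb R^{a_\mu\times b_\nu}$. Projections: $\mathscr U\begin{pmatrix}J_{11}&J_{12}\\ J_{21}&J_{22}\end{pmatrix}:=\begin{pmatrix}0&J_{12}\\0&0\end{pmatrix}$ and $\mathscr R(J_1\ \ J_2):=(0\ \ J_2)$. Class $\mathcal G_2$ (plants): $$\begin{pmatrix}\dot x\\ \hat z\\ z_p\\ y\end{pmatrix}=\begin{pmatrix}\hat A_{11}&\hat A_{12}&\hat B_1^p&\hat B_1\\ \hat A_{21}&\hat A_{22}&\hat B_2^p&\hat B_2\\ \hat C_1^p&\hat C_2^p&\hat D^p&\hat E\\ \hat C_1&\hat C_2&\hat F&0\end{pmatrix}\begin{pmatrix}x\\ \hat w\\ w_p\\ u\end{pmatrix},\quad \hat w=\hat\Delta(\Delta)\hat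 z,\quad \hat\Delta(\Delta)=\Delta,$$ $x,\hat w,\hat z,w_p,z_p,u,y$ of dimensions $|n|,r,s,m^p,k^p,|m|,|k|$, with $n=(n_1,n_2)$, $m=(m_1,m_2)$, $k=(k_1,k_2)$, $r=r_\Delta$, $s=s_\Delta$; $\hat A_{11},\hat B_1,\hat C_1$ are lower block triangular (partitions $n\times n$, $n\times m$, $k\times n$), the last $n_2$ columns of $\hat A_{21}$ and the last $m_2$ columns of $\hat B_2$ are zero, and all other matrices are unstructured. Class $\mathcal K_2$ (controllers): $$\begin{pmatrix}\dot x_c\\ \hat z_c\\ u\end{pmatrix}=\begin{pmatrix}\hat A^c_{11}&\hat A^c_{12}&\hat B^c_1\\ \hat A^c_{21}&\hat A^c_{22}&\hat B^c_2\\ \hat C^c_1&\hat C^c_2&\hat D^c\end{pmatrix}\begin{pmatrix}x_c\\ \hat w_c\\ y\end{pmatrix},\quad \hat w_c=\hat\Delta_c(\Delta)\hat z_c,$$ with $x_c,\hat w_c,\hat z_c$ of dimensions $|n^c|,r^c,s^c$ for free $n^c=(n^c_1,n^c_2)\in\mathbb N_0^2$, $r^c,s^c\in\mathbb N_0$; $\hat A^c_{11},\hat B^c_1,\hat C^c_1,\hat D^c$ are lower block triangular (partitions $n^c\times n^c$, $n^c\times k$, $m\times n^c$, $m\times k$), the last $n^c_2$ columns of $\hat A^c_{21}$ and the last $k_2$ columns of $\hat B^c_2$ are zero, $\hat A^c_{12},\hat A^c_{22},\hat C^c_2$ are unstructured, and $\hat\Delta_c:\mathbf V\to\mathbb R^{r^c\times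 s^c}$ is an arbitrary function. Lifted plant, with $l:=(r,s)$, $|l|=r+s$: $A_{11}=\hat A_{11}$, $A_{12}=(\hat A_{12}\ \ 0)$, $A_{21}=\begin{pmatrix}0\\2\hat A_{21}\end{pmatrix}$, $A_{22}=\begin{pmatrix}I_r&0\\2\hat A_{22}&-I_s\end{pmatrix}$, $B_1^p=\hat B_1^p$, $B_2^p=\begin{pmatrix}0\\2\hat B_2^p\end{pmatrix}$, $B_1=\hat B_1$, $B_2=\begin{pmatrix}0\\2\hat B_2\end{pmatrix}$, $C_1^p=\hat C_1^p$, $C_2^p=(\hat C_2^p\ \ 0)$, $C_1=\hat C_1$, $C_2=(\hat C_2\ \ 0)$, $D^p=\hat D^p$, $E=\hat E$, $F=\hat F$, $\Delta_l(\Delta)=\begin{pmatrix}-I_r&2\hat\Delta(\Delta)\\0&I_s\end{pmatrix}$. Closed loop of the lifted plant with the controller ($r^c=s^c=l^c$): for $i,j=1,2$, $$\begin{pmatrix}\mathcal A_{ij}&\mathcal B_i\\ \mathcal C_j&\mathcal D\end{pmatrix}=\begin{pmatrix}A_{ij}&0&B_i^p\\0&0&0\\ C_j^p&0&D^p\end{pmatrix}+\begin{pmatrix}0&B_i\\ I&0\\0&E\end{pmatrix}\begin{pmatrix}\hat A^c_{ij}&\hat B^c_i\\ \hat C^c_j&\hat D^c\end{pmatrix}\begin{pmatrix}0&I&0\\ C_j&0&F\end{pmatrix},$$ $\Delta_{lc}(\Delta):=\mathrm{diag}(\Delta_l(\Delta),\hat\Delta_c(\Delta))$, and $\mathbf P$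 (depending on $\hat\Delta_c$) is the set of symmetric $\mathcal P$ of size $r+s+l^c$ with $\begin{pmatrix}\Delta_{lc}(\Delta)\\ I\end{pmatrix}^T\begin{pmatrix}0&\mathcal P\\ \mathcal P&0\end{pmatrix}\begin{pmatrix}\Delta_{lc}(\Delta)\\ I\end{pmatrix}\succ0$ for all $\Delta\in\mathbf V$. Scaling classes (multiplier variables): $\mathbf P_p$ is the set of symmetric $P$ of size $r+s$ with $\begin{pmatrix}I_r\\0\end{pmatrix}^TP\begin{pmatrix}I_r\\0\end{pmatrix}\prec0$ and $\begin{pmatrix}\hat\Delta(\Delta)\\ I_s\end{pmatrix}^TP\begin{pmatrix}\hat\Delta(\Delta)\\ I_s\end{pmatrix}\succ0$ for all $\Delta\in\mathbf V$; $\mathbf P_d$ is the set of symmetric $\tilde P$ of size $r+s$ with $\begin{pmatrix}0\\ I_s\end{pmatrix}^T\tilde P\begin{pmatrix}0\\ I_s\end{pmatrix}\succ0$ and $\begin{pmatrix}I_r\\-\hat\Delta(\Delta)^T\end{pmatrix}^T\tilde P\begin{pmatrix}I_r\\-\hat\Delta(\Delta)^T\end{pmatrix}\prec0$ for all $\Delta\in\mathbf V$. Partitions: $a=u:=(|n|,|n|)$. Lyapunov variables: symmetric $S_3,T_1\in\mathbb R^{|n|\times|n|}$, symmetric $S_{22}\in\mathbb R^{n_1\times n_1}$, $T_{22}\in\mathbb R^{n_2\times n_2}$, and $W\in\mathbb R^{n_2\times n_1}$; set $$S_2:=\begin{pmatrix}S_{22}&W^T\\0&I_{n_2}\end{pmatrix},\quad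 T_2:=\begin{pmatrix}I_{n_1}&0\\-W&T_{22}\end{pmatrix},\quad X_1:=(S_2\ \ S_3)\in\mathbb R^{|n|\times2|n|},\quad Y_1:=(T_1\ \ T_2)\in\mathbb R^{|n|\times2|n|},$$ $$\mathbb X:=\begin{pmatrix}T_1&T_2&I\\ T_2^T&T_2^TS_2&S_2^T\\ I&S_2&S_3\end{pmatrix},$$ which is symmetric. Controller variables: $\mathsf K_{11},\mathsf L_1,\mathsf M_1,\mathsf N$ lower block triangular of partitions $a\times u$, $a\times k$, $m\times u$, $m\times k$; $\mathsf K_{12}\in\mathbb R^{2|n|\times|l|}$, $\mathsf K_{22}\in\mathbb R^{|l|\times|l|}$, $\mathsf M_2\in\mathbb R^{|m|\times|l|}$ unstructured; $\mathsf K_{21}\in\mathbb R^{|l|\times2|n|}$ with last $|n|$ columns zero; $\mathsf L_2\in\mathbb R^{|l|\times|k|}$ with last $k_2$ columns zero. $\mathscr U$ is applied in the partitions $a\times u$, $a\times k$, $m\times u$, and $\mathscr R$ in the column partition $u$. Auxiliary matrices: with $\tilde B_1$ the last $m_2$ columns of $B_1$ and $\tilde C_1$ the first $k_1$ rows of $C_1$, $B_1^e:=\begin{pmatrix}0&\tilde B_1\\0&0\end{pmatrix}$ of partition $a\times m$ and $C_1^e:=\begin{pmatrix}0&\tilde C_1\\0&0\end{pmatrix}$ of partition $k\times u$. *)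

(* Defs.v *)
From mathcomp Require Import all_boot all_order all_algebra.
From mathcomp Require Import classical_sets reals.

Set Implicit Arguments.
Unset Strict Implicit.
Unset Printing Implicit Defensive.

Import Order.TTheory GRing.Theory Num.Theory.

Local Open Scope ring_scope.

Section MatrixNotions.
Variable R : realType.

Definition posdef n (P : 'M[R]_n) : Prop :=
  P^T = P /\ forall x : 'cV[R]_n, x != 0 -> 0 < (x^T *m P *m x) 0 0.

Definition negdef n (P : 'M[R]_n) : Prop :=
  P^T = P /\ forall x : 'cV[R]_n, x != 0 -> (x^T *m P *m x) 0 0 < 0.

Definition conv_hull p q N (D : 'I_N -> 'M[R]_(p, q)) : set 'M[R]_(p, q) :=
  [set X | exists t : 'I_N -> R,
     [/\ forall i, 0 <= t i, \sum_i t i = 1 & X = \sum_i t i *: D i]].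

Definition affine_on p q p' q' (V : set 'M[R]_(p, q))
    (f : 'M[R]_(p, q) -> 'M[R]_(p', q')) : Prop :=
  exists (F0 : 'M[R]_(p', q')) (L : {linear 'M[R]_(p, q) -> 'M[R]_(p', q')}),
    forall X, V X -> f X = F0 + L X.

Definition lower_btri a1 a2 b1 b2 (J : 'M[R]_(a1 + a2, b1 + b2)) : Prop :=
  ursubmx J = 0.

Definition last_cols0 a b1 b2 (J : 'M[R]_(a, b1 + b2)) : Prop := rsubmx J = 0.

Definition projU a1 a2 b1 b2 (J : 'M[R]_(a1 + a2, b1 + b2)) :
    'M[R]_(a1 + a2, b1 + b2) :=
  block_mx 0 (ursubmx J) 0 0.

Definition projR a b1 b2 (J : 'M[R]_(a, b1 + b2)) : 'M[R]_(a, b1 + b2) :=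
  row_mx 0 (rsubmx J).

Definition antidiag p (P : 'M[R]_p) : 'M[R]_(p + p) := block_mx 0 P P 0.

End MatrixNotions.

(* Data of a plant with state dimension n, scheduling channel w = Delta z of
   dimensions r (w) and s (z), performance channel mp -> kp and control channel
   m -> k (whose direct feedthrough is 0 and hence not recorded). *)
Record plant (R : realType) (n r s mp kp m k : nat) := Plant {
  gA11 : 'M[R]_(n, n);   gA12 : 'M[R]_(n, r);
  gB1p : 'M[R]_(n, mp);  gB1  : 'M[R]_(n, m);
  gA21 : 'M[R]_(s, n);   gA22 : 'M[R]_(s, r);
  gB2p : 'M[R]_(s, mp);  gB2  : 'M[R]_(s, m);
  gC1p : 'M[R]_(kp, n);  gC2p : 'M[R]_(kp, r);
  gDp  : 'M[R]_(kp, mp); gE   : 'M[R]_(kp, m);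
  gC1  : 'M[R]_(k, n);   gC2  : 'M[R]_(k, r);
  gF   : 'M[R]_(k, mp) }.

(* Data of a controller; the scheduling function cDelta is total on matrices,
   but only its values on the scheduling set V are ever used. *)
Record controller (R : realType) (r s nc rc sc m k : nat) := Controller {
  cA11 : 'M[R]_(nc, nc); cA12 : 'M[R]_(nc, rc); cB1 : 'M[R]_(nc, k);
  cA21 : 'M[R]_(sc, nc); cA22 : 'M[R]_(sc, rc); cB2 : 'M[R]_(sc, k);
  cC1  : 'M[R]_(m, nc);  cC2  : 'M[R]_(m, rc);  cD  : 'M[R]_(m, k);
  cDelta : 'M[R]_(r, s) -> 'M[R]_(rc, sc) }.

Section Classes.
Variable R : realType.

Definition classG2 n1 n2 r s mp kp m1 m2 k1 k2
    (G : plant R (n1 + n2) r s mp kp (m1 + m2) (k1 + k2)) : Prop :=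
  [/\ lower_btri (gA11 G), lower_btri (gB1 G), lower_btri (gC1 G),
      last_cols0 (gA21 G) & last_cols0 (gB2 G)].

Definition classK2 r s nc1 nc2 rc sc m1 m2 k1 k2
    (K : controller R r s (nc1 + nc2) rc sc (m1 + m2) (k1 + k2)) : Prop :=
  [/\ [/\ lower_btri (cA11 K), lower_btri (cB1 K),
          lower_btri (cC1 K) & lower_btri (cD K)],
      last_cols0 (cA21 K) & last_cols0 (cB2 K)].

Definition lift_plant n r s mp kp m k (G : plant R n r s mp kp m k) :
    plant R n (r + s) (r + s) mp kp m k :=
  {| gA11 := gA11 G;
     gA12 := row_mx (gA12 G) 0;
     gB1p := gB1p G;
     gB1  := gB1 G;
     gA21 := col_mx 0 (2 *: gA21 G);
     gA22 := block_mx 1%:M 0 (2 *: gA22 G) (- 1%:M);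
     gB2p := col_mx 0 (2 *: gB2p G);
     gB2  := col_mx 0 (2 *: gB2 G);
     gC1p := gC1p G;
     gC2p := row_mx (gC2p G) 0;
     gDp  := gDp G;
     gE   := gE G;
     gC1  := gC1 G;
     gC2  := row_mx (gC2 G) 0;
     gF   := gF G |}.

Definition lift_Delta r s (D : 'M[R]_(r, s)) : 'M[R]_(r + s) :=
  block_mx (- 1%:M) (2 *: D) 0 1%:M.

Definition Delta_lc r s lc (Dc : 'M[R]_(r, s) -> 'M[R]_lc) (D : 'M[R]_(r, s)) :
    'M[R]_((r + s) + lc) :=
  block_mx (lift_Delta D) 0 0 (Dc D).

Definition classP r s lc (V : set 'M[R]_(r, s)) (Dc : 'M[R]_(r, s) -> 'M[R]_lc) :
    set 'M[R]_((r + s) + lc) :=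
  [set P | P^T = P /\ forall D, V D ->
     posdef ((col_mx (Delta_lc Dc D) 1%:M)^T *m antidiag P
             *m col_mx (Delta_lc Dc D) 1%:M)].

Definition classPp r s (V : set 'M[R]_(r, s)) : set 'M[R]_(r + s) :=
  [set P | [/\ P^T = P,
     negdef ((col_mx 1%:M 0 : 'M[R]_(r + s, r))^T *m P *m col_mx 1%:M 0) &
     forall D, V D -> posdef ((col_mx D 1%:M)^T *m P *m col_mx D 1%:M)]].

Definition classPd r s (V : set 'M[R]_(r, s)) : set 'M[R]_(r + s) :=
  [set P | [/\ P^T = P,
     posdef ((col_mx 0 1%:M : 'M[R]_(r + s, s))^T *m P *m col_mx 0 1%:M) &
     forall D, V D ->
       negdef ((col_mx 1%:M (- D^T))^T *m P *m col_mx 1%:M (- D^T))]].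

End Classes.

(* The blocks A_ij, B_i, C_j, D (i, j = 1, 2) entering the performance
   inequality; nx and nl are the sizes of the first and second channel. *)
Record perf_sys (R : realType) (nx nl mp kp : nat) := PerfSys {
  pA11 : 'M[R]_(nx, nx); pA12 : 'M[R]_(nx, nl); pB1 : 'M[R]_(nx, mp);
  pA21 : 'M[R]_(nl, nx); pA22 : 'M[R]_(nl, nl); pB2 : 'M[R]_(nl, mp);
  pC1  : 'M[R]_(kp, nx); pC2  : 'M[R]_(kp, nl); pD  : 'M[R]_(kp, mp) }.

Section PerformanceInequality.
Variable R : realType.

Definition perf_factor nx nl mp kp (S : perf_sys R nx nl mp kp) :
    'M[R]_(((nx + nx) + (nl + nl)) + (mp + kp), (nx + nl) + mp) :=
  col_mx
    (col_mx
      (col_mx (row_mx (row_mx 1%:M 0) 0)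
              (row_mx (row_mx (pA11 S) (pA12 S)) (pB1 S)))
      (col_mx (row_mx (row_mx 0 1%:M) 0)
              (row_mx (row_mx (pA21 S) (pA22 S)) (pB2 S))))
    (col_mx (row_mx (row_mx 0 0) 1%:M)
            (row_mx (row_mx (pC1 S) (pC2 S)) (pD S))).

Definition perf_middle nx nl mp kp (gamma : R) (X : 'M[R]_nx) (P : 'M[R]_nl) :
    'M[R]_(((nx + nx) + (nl + nl)) + (mp + kp)) :=
  block_mx (block_mx (antidiag X) 0 0 (antidiag P)) 0
           0 (block_mx (- gamma)%:M 0 0 1%:M).

Definition perf_form nx nl mp kp (gamma : R) (S : perf_sys R nx nl mp kp)
    (X : 'M[R]_nx) (P : 'M[R]_nl) : 'M[R]_((nx + nl) + mp) :=
  (perf_factor S)^T *m perf_middle mp kp gamma X P *m perf_factor S.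

End PerformanceInequality.

Section ClosedLoop.
Variable R : realType.

(* The matrix (A_ij B_i; C_j D) of the closed loop for one pair (i, j), with
   (p, pc) the plant and controller dimensions of the i-th row channel and
   (q, qc) those of the j-th column channel. *)
Definition cl_block p pc q qc mp kp m k
    (A : 'M[R]_(p, q)) (Bp : 'M[R]_(p, mp)) (B : 'M[R]_(p, m))
    (Cp : 'M[R]_(kp, q)) (C : 'M[R]_(k, q))
    (Dp : 'M[R]_(kp, mp)) (E : 'M[R]_(kp, m)) (F : 'M[R]_(k, mp))
    (Ac : 'M[R]_(pc, qc)) (Bc : 'M[R]_(pc, k))
    (Cc : 'M[R]_(m, qc)) (Dc : 'M[R]_(m, k)) :
    'M[R]_((p + pc) + kp, (q + qc) + mp) :=
  block_mx (block_mx A 0 0 0) (col_mx Bp 0) (row_mx Cp 0) Dp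
  + (block_mx (col_mx 0 1%:M) (col_mx B 0) 0 E : 'M[R]_((p + pc) + kp, pc + m))
    *m block_mx Ac Bc Cc Dc
    *m (block_mx (row_mx 0 1%:M) 0 (row_mx C 0) F
          : 'M[R]_(qc + k, (q + qc) + mp)).

(* B_i, C_j and D are read off from any block (i, j): the corresponding parts
   of cl_block do not depend on the remaining index. *)
Definition closed_loop r s n l mp kp m k nc lc (G : plant R n l l mp kp m k)
    (K : controller R r s nc lc lc m k) : perf_sys R (n + nc) (l + lc) mp kp :=
  let S11 := cl_block (gA11 G) (gB1p G) (gB1 G) (gC1p G) (gC1 G)
               (gDp G) (gE G) (gF G) (cA11 K) (cB1 K) (cC1 K) (cD K) in
  let S12 := cl_block (gA12 G) (gB1p G) (gB1 G) (gC2p G) (gC2 G)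
               (gDp G) (gE G) (gF G) (cA12 K) (cB1 K) (cC2 K) (cD K) in
  let S21 := cl_block (gA21 G) (gB2p G) (gB2 G) (gC1p G) (gC1 G)
               (gDp G) (gE G) (gF G) (cA21 K) (cB2 K) (cC1 K) (cD K) in
  let S22 := cl_block (gA22 G) (gB2p G) (gB2 G) (gC2p G) (gC2 G)
               (gDp G) (gE G) (gF G) (cA22 K) (cB2 K) (cC2 K) (cD K) in
  {| pA11 := ulsubmx S11; pA12 := ulsubmx S12; pB1 := ursubmx S11;
     pA21 := ulsubmx S21; pA22 := ulsubmx S22; pB2 := ursubmx S22;
     pC1  := dlsubmx S11; pC2  := dlsubmx S22; pD  := drsubmx S11 |}.

(* The matrix inequality certifying performance level gamma for the lifted
   plant in closed loop with K. *)
Definition analysis_lmi n r s mp kp m k nc lc (gamma : R)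
    (G : plant R n r s mp kp m k) (K : controller R r s nc lc lc m k)
    (X1 : 'M[R]_(n + nc)) (P : 'M[R]_((r + s) + lc)) : Prop :=
  negdef (perf_form gamma (closed_loop (lift_plant G) K) X1 P).

End ClosedLoop.

Record lyap_vars (R : realType) (n1 n2 : nat) := LyapVars {
  vS3 : 'M[R]_(n1 + n2); vT1 : 'M[R]_(n1 + n2);
  vS22 : 'M[R]_n1; vT22 : 'M[R]_n2; vW : 'M[R]_(n2, n1) }.

(* The sans-serif variables K_ij, L_i, M_j, N; here n, l, m, k are the total
   dimensions |n|, |l|, |m|, |k|. *)
Record ctrl_vars (R : realType) (n l m k : nat) := CtrlVars {
  vK11 : 'M[R]_(n + n, n + n); vK12 : 'M[R]_(n + n, l); vL1 : 'M[R]_(n + n, k);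
  vK21 : 'M[R]_(l, n + n);     vK22 : 'M[R]_(l, l);     vL2 : 'M[R]_(l, k);
  vM1  : 'M[R]_(m, n + n);     vM2  : 'M[R]_(m, l);     vN  : 'M[R]_(m, k) }.

Section Synthesis.
Variable R : realType.

Definition lyap_sym n1 n2 (v : lyap_vars R n1 n2) : Prop :=
  [/\ (vS3 v)^T = vS3 v, (vT1 v)^T = vT1 v,
      (vS22 v)^T = vS22 v & (vT22 v)^T = vT22 v].

Definition ctrl_structured n l m1 m2 k1 k2
    (v : ctrl_vars R n l (m1 + m2) (k1 + k2)) : Prop :=
  [/\ [/\ lower_btri (vK11 v), lower_btri (vL1 v),
          lower_btri (vM1 v) & lower_btri (vN v)],
      last_cols0 (vK21 v) & last_cols0 (vL2 v)].

Section LyapunovBlocks.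
Variables (n1 n2 : nat) (v : lyap_vars R n1 n2).
Notation n := (n1 + n2)%N.

Definition lyS2 : 'M[R]_n := block_mx (vS22 v) (vW v)^T 0 1%:M.
Definition lyT2 : 'M[R]_n := block_mx 1%:M 0 (- vW v) (vT22 v).
Definition lyX1 : 'M[R]_(n, n + n) := row_mx lyS2 (vS3 v).
Definition lyY1 : 'M[R]_(n, n + n) := row_mx (vT1 v) lyT2.

Definition lyXX : 'M[R]_(n + (n + n)) :=
  block_mx (vT1 v) (row_mx lyT2 1%:M)
           (col_mx lyT2^T 1%:M) (block_mx (lyT2^T *m lyS2) lyS2^T
                                          lyS2            (vS3 v)).

End LyapunovBlocks.

(* The counterpart of cl_block after the transformation of variables;
   (p, p') are the sizes of X_i and (q, q') those of Y_j. *)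
Definition syn_block p p' q q' mp kp m k
    (A : 'M[R]_(p, q)) (Bp : 'M[R]_(p, mp)) (B : 'M[R]_(p, m))
    (Cp : 'M[R]_(kp, q)) (C : 'M[R]_(k, q))
    (Dp : 'M[R]_(kp, mp)) (E : 'M[R]_(kp, m)) (F : 'M[R]_(k, mp))
    (X : 'M[R]_(p, p')) (Y : 'M[R]_(q, q'))
    (K : 'M[R]_(p', q')) (L : 'M[R]_(p', k))
    (M : 'M[R]_(m, q')) (N : 'M[R]_(m, k)) :
    'M[R]_((p + p') + kp, (q' + q) + mp) :=
  block_mx (block_mx (A *m Y) A 0 (X^T *m A)) (col_mx Bp (X^T *m Bp))
           (row_mx (Cp *m Y) Cp) Dp
  + (block_mx (col_mx 0 1%:M) (col_mx B 0) 0 E : 'M[R]_((p + p') + kp, p' + m))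
    *m block_mx K L M N
    *m (block_mx (row_mx 1%:M 0) 0 (row_mx 0 C) F
          : 'M[R]_(q' + k, (q' + q) + mp)).

Section SynthesisSystem.
Variables (n1 n2 l mp kp m1 m2 k1 k2 : nat).
Notation n := (n1 + n2)%N.
Notation m := (m1 + m2)%N.
Notation k := (k1 + k2)%N.
(* G stands for the lifted plant. *)
Variables (G : plant R n l l mp kp m k) (v : lyap_vars R n1 n2).
Variables (X2 Y2 : 'M[R]_l) (c : ctrl_vars R n l m k).

Definition synB1e : 'M[R]_(n + n, m) := block_mx 0 (rsubmx (gB1 G)) 0 0.
Definition synC1e : 'M[R]_(k, n + n) := block_mx 0 (usubmx (gC1 G)) 0 0.

Definition synN : 'M[R]_(m, k) := vN c.
Definition synL1 : 'M[R]_(n + n, k) := vL1 c + projU (synB1e *m vN c).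
Definition synM1 : 'M[R]_(m, n + n) := vM1 c + projU (vN c *m synC1e).
Definition synK11 : 'M[R]_(n + n, n + n) :=
  vK11 c + projU ((lyX1 v)^T *m gA11 G *m lyY1 v) + projU (synB1e *m vM1 c)
  + projU (vL1 c *m synC1e) - synB1e *m vN c *m synC1e.
Definition synL2 : 'M[R]_(l, k) := vL2 c.
Definition synM2 : 'M[R]_(m, l) := vM2 c.
Definition synK12 : 'M[R]_(n + n, l) := vK12 c.
Definition synK22 : 'M[R]_(l, l) := vK22 c.
Definition synK21 : 'M[R]_(l, n + n) :=
  vK21 c + projR (X2^T *m gA21 G *m lyY1 v) + projR (vL2 c *m synC1e).

(* The rows of the first channel are partitioned as n + (n + n), its columns as
   (n + n) + n; row_cast identifies both index sets in the order-preserving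
   way. As in closed_loop, B_i, C_j and D do not depend on the block (i, j)
   they are read off from. *)
Definition row_cast q (J : 'M[R]_(n + (n + n), q)) : 'M[R]_((n + n) + n, q) :=
  castmx (addnA n n n, erefl q) J.

Definition syn_sys : perf_sys R ((n + n) + n) (l + l) mp kp :=
  let S11 := syn_block (gA11 G) (gB1p G) (gB1 G) (gC1p G) (gC1 G)
               (gDp G) (gE G) (gF G) (lyX1 v) (lyY1 v) synK11 synL1 synM1 synN in
  let S12 := syn_block (gA12 G) (gB1p G) (gB1 G) (gC2p G) (gC2 G)
               (gDp G) (gE G) (gF G) (lyX1 v) Y2 synK12 synL1 synM2 synN in
  let S21 := syn_block (gA21 G) (gB2p G) (gB2 G) (gC1p G) (gC1 G)
               (gDp G) (gE G) (gF G) X2 (lyY1 v) synK21 synL2 synM1 synN in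
  let S22 := syn_block (gA22 G) (gB2p G) (gB2 G) (gC2p G) (gC2 G)
               (gDp G) (gE G) (gF G) X2 Y2 synK22 synL2 synM2 synN in
  {| pA11 := row_cast (ulsubmx S11); pA12 := row_cast (ulsubmx S12);
     pB1  := row_cast (ursubmx S11);
     pA21 := ulsubmx S21; pA22 := ulsubmx S22; pB2 := ursubmx S22;
     pC1  := dlsubmx S11; pC2  := dlsubmx S22; pD  := drsubmx S11 |}.

End SynthesisSystem.

(* The performance inequality of the transformed system has both certificate
   matrices equal to the identity. *)
Definition synthesis_lmi n1 n2 r s mp kp m1 m2 k1 k2 (gamma : R)
    (G : plant R (n1 + n2) r s mp kp (m1 + m2) (k1 + k2))
    (v : lyap_vars R n1 n2) (X2 Y2 : 'M[R]_(r + s))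
    (c : ctrl_vars R (n1 + n2) (r + s) (m1 + m2) (k1 + k2)) : Prop :=
  negdef (perf_form gamma (syn_sys (lift_plant G) v X2 Y2 c) 1%:M 1%:M).

End Synthesis.

(* Main.v *)
(* Given a certificate X of the first channel, put T = [Y1 I; Z1 0] with
   T^T X = [I 0; X1^T U1], where Z1 and U1 are lower block triangular; likewise for
   the multiplier P with X2, Y2, which are the upper left blocks of P and P^-1.
   The congruence with T turns (1) into the inequality of (ii), the controller
   being replaced by the image of its parameters under
   [Ac Bc; Cc D] |-> [U X^T B; 0 I] [Ac Bc; Cc D] [Z 0; C Y I] + [X^T A Y 0; 0 0],
   whose blocks that must vanish or are prescribed are computed from the
   triangular shape of S2, T2, B1 and C1.
   From (ii) to (i), T is invertible for Z1 = I, Z2 = I, and the scheduling function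
   is chosen to annihilate the off-diagonal blocks of the multiplier condition; this
   needs I - X2 Y2 invertible, which a rescaling of X2 achieves.
   From (i) to (ii), T need not have full column rank, so the congruence only gives
   nonstrict inequalities; they are made strict by perturbing K11 and K22 inside
   their structure, and then S3 and T1. *)
From HB Require Import structures.
Require Import Defs.
From mathcomp Require Import all_boot all_order all_algebra.
From mathcomp Require Import classical_sets reals.
From mathcomp Require Import ring lra.
Import Order.TTheory GRing.Theory Num.Theory.
Local Open Scope ring_scope.

Set Implicit Arguments.
Unset Strict Implicit.
Unset Printing Implicit Defensive.

(** * Positive definite forms *)

(** [lift_Delta D] is an involution. Splitting along its eigenspaces turns [classPp] and [classPd]
    into strict positivity of a form linear in [lift_Delta D], and the closed-loop multiplier
    condition is linear in the scheduling function, so solving for that function gives an affine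
    one. The obstacle is structural: products such as [X1^T B1 M1] and [L1 C1 Y1] mix Lyapunov and
    controller variables in the very blocks that the controller must have zero. The unit blocks of
    [S2] and [T2] sit where the last columns of [B1] and the first rows of [C1] meet them, so these
    blocks reduce to terms in [B1e] and [C1e], which hold plant data only; the entries [W^T] and
    [- W] cancel in [T2^T S2]. From a certificate, such [S2] and [T2] arise by block elimination
    after grouping plant and controller states by index. The perturbations of [X2], [S3] and [T1]
    run along lines on which [perf_factor] is affine, so the form changes by a quadratic polynomial
    in the parameter and strictness persists near 0. *)

Section Dot.
Variable R : realType.
Implicit Types (n p q : nat).

Definition dot n (x y : 'cV[R]_n) : R := (x^T *m y) 0 0.

Lemma dotE n (x y : 'cV[R]_n) : dot x y = \sum_i x i 0 * y i 0.
Proof. by rewrite /dot mxE; apply: eq_bigr => i _; rewrite mxE. Qed.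

Lemma dotC n (x y : 'cV[R]_n) : dot x y = dot y x.
Proof. by rewrite !dotE; apply: eq_bigr => i _; rewrite mulrC. Qed.

Lemma dotDr n (x y z : 'cV[R]_n) : dot x (y + z) = dot x y + dot x z.
Proof. by rewrite /dot mulmxDr mxE. Qed.

Lemma dotDl n (x y z : 'cV[R]_n) : dot (y + z) x = dot y x + dot z x.
Proof. by rewrite dotC dotDr !(dotC x). Qed.

Lemma dotZr n a (x y : 'cV[R]_n) : dot x (a *: y) = a * dot x y.
Proof. by rewrite /dot -scalemxAr mxE. Qed.

Lemma dotZl n a (x y : 'cV[R]_n) : dot (a *: x) y = a * dot x y.
Proof. by rewrite dotC dotZr dotC. Qed.

Lemma dotNr n (x y : 'cV[R]_n) : dot x (- y) = - dot x y.
Proof. by rewrite -scaleN1r dotZr mulN1r. Qed.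

Lemma dotNl n (x y : 'cV[R]_n) : dot (- x) y = - dot x y.
Proof. by rewrite dotC dotNr dotC. Qed.

Lemma dot0r n (x : 'cV[R]_n) : dot x 0 = 0.
Proof. by rewrite -(scale0r 0) dotZr mul0r. Qed.

Lemma dot0l n (x : 'cV[R]_n) : dot 0 x = 0.
Proof. by rewrite dotC dot0r. Qed.

Definition dotS := (dotDl, dotDr, dotNl, dotNr, dotZl, dotZr, dot0l, dot0r).

Lemma dot_mulr n p (x : 'cV[R]_p) (A : 'M[R]_(p, n)) (y : 'cV[R]_n) :
  dot x (A *m y) = dot (A^T *m x) y.
Proof. by rewrite /dot trmx_mul trmxK mulmxA. Qed.

Lemma dot_mull n p (x : 'cV[R]_n) (A : 'M[R]_(p, n)) (y : 'cV[R]_p) :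
  dot (A *m x) y = dot x (A^T *m y).
Proof. by rewrite dot_mulr trmxK. Qed.

Lemma dot_ge0 n (x : 'cV[R]_n) : 0 <= dot x x.
Proof. by rewrite dotE sumr_ge0 // => i _; rewrite -expr2 sqr_ge0. Qed.

Lemma dot_eq0 n (x : 'cV[R]_n) : dot x x = 0 -> x = 0.
Proof.
rewrite dotE => /eqP; rewrite psumr_eq0 => [/allP x0|i _]; last by rewrite -expr2 sqr_ge0.
apply/matrixP => i j; rewrite (ord1 j) mxE.
by move/(_ i (mem_index_enum _)): x0; rewrite mulf_eq0 orbb => /eqP.
Qed.

Lemma dot_gt0 n (x : 'cV[R]_n) : x != 0 -> 0 < dot x x.
Proof.
by rewrite lt0r dot_ge0 andbT; apply: contra_neq; apply: dot_eq0.
Qed.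

Lemma dot_col n p (a c : 'cV[R]_n) (b d : 'cV[R]_p) :
  dot (col_mx a b) (col_mx c d) = dot a c + dot b d.
Proof. by rewrite /dot tr_col_mx mul_row_col mxE. Qed.

Lemma qformE n (x : 'cV[R]_n) (P : 'M[R]_n) : (x^T *m P *m x) 0 0 = dot x (P *m x).
Proof. by rewrite -mulmxA. Qed.

Lemma posdef_sym n (P : 'M[R]_n) : posdef P -> P^T = P.
Proof. by case. Qed.

Lemma posdef_gt0 n (P : 'M[R]_n) x : posdef P -> x != 0 -> 0 < dot x (P *m x).
Proof. by move=> [_ H] /H; rewrite qformE. Qed.

Lemma posdef_ge0 n (P : 'M[R]_n) x : posdef P -> 0 <= dot x (P *m x).
Proof.
move=> HP; have [->|x0] := eqVneq x 0; first by rewrite dot0l.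
exact/ltW/posdef_gt0.
Qed.

Lemma posdefN n (P : 'M[R]_n) : negdef P <-> posdef (- P).
Proof.
split=> -[symP H]; split.
- by rewrite linearN /= symP.
- by move=> x /H; rewrite !qformE mulNmx dotNr oppr_gt0.
- by move: symP; rewrite linearN /= => /oppr_inj.
- by move=> x /H; rewrite !qformE mulNmx dotNr oppr_gt0.
Qed.

Lemma inj_unitmx n (A : 'M[R]_n) :
  (forall x : 'cV[R]_n, A *m x = 0 -> x = 0) -> A \in unitmx.
Proof.
move=> H; rewrite -unitmx_tr unitmxE unitfE; apply/det0P => -[v v0 vA].
move/eqP: v0; apply; apply: trmx_inj; rewrite trmx0; apply: H.
by apply: trmx_inj; rewrite trmx_mul trmxK vA trmx0.
Qed.

Lemma unitmx_inj n p (A : 'M[R]_n) (x : 'M[R]_(n, p)) :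
  A \in unitmx -> A *m x = 0 -> x = 0.
Proof. by move=> uA /(congr1 (mulmx (invmx A))); rewrite mulKmx // mulmx0. Qed.

Lemma posdef_unit n (P : 'M[R]_n) : posdef P -> P \in unitmx.
Proof.
move=> HP; apply: inj_unitmx => x Px; apply/eqP; apply: contraT => x0.
by have := posdef_gt0 HP x0; rewrite Px dot0r ltxx.
Qed.

Lemma posdef_inv n (P : 'M[R]_n) : posdef P -> posdef (invmx P).
Proof.
move=> HP; have uP := posdef_unit HP; split; first by rewrite trmx_inv posdef_sym.
move=> x x0; rewrite qformE -{1}(mulKVmx uP x) dotC.
apply: posdef_gt0 HP _; apply: contraNneq x0 => Px0.
by rewrite -(mulKVmx uP x) Px0 mulmx0.
Qed.

Lemma posdef_congr n p (P : 'M[R]_n) (T : 'M[R]_(n, p)) : posdef P ->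
  (forall x : 'cV[R]_p, T *m x = 0 -> x = 0) -> posdef (T^T *m P *m T).
Proof.
move=> HP injT; split; first by rewrite !trmx_mul trmxK posdef_sym // mulmxA.
move=> x x0; rewrite qformE -!mulmxA dot_mulr trmxK; apply: posdef_gt0 => //.
by apply: contra_neq x0; apply: injT.
Qed.

Lemma posdef_CS n (P : 'M[R]_n) (x y : 'cV[R]_n) : posdef P ->
  dot x (P *m y) ^+ 2 <= dot x (P *m x) * dot y (P *m y).
Proof.
move=> HP; have [->|y0] := eqVneq y 0; first by rewrite mulmx0 !dot0r expr0n mulr0.
have qy := posdef_gt0 HP y0.
have xy : dot y (P *m x) = dot x (P *m y) by rewrite dot_mulr posdef_sym // dotC.
(* Nonnegativity at this vector is the claimed inequality multiplied by [dot y (P *m y)]. *)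
have := posdef_ge0 (dot y (P *m y) *: x - dot x (P *m y) *: y) HP.
rewrite mulmxBr -!scalemxAr !dotS xy.
set a := dot x (P *m x); set b := dot x _; set q := dot y _ in qy * => H.
have {H}: 0 <= q * (a * q - b ^+ 2).
  by apply: le_trans H _; rewrite le_eqVlt; apply/orP; left; apply/eqP; ring.
by rewrite pmulr_rge0 // subr_ge0.
Qed.

(** Cauchy-Schwarz in the inner product of [P]: since [x_i = <P^-1 e_i, x>_P], one gets
    [|x|^2 <= tr(P^-1) x^T P x], without compactness. The [1 +] keeps the constant positive in
    dimension 0. *)
Lemma posdef_coercive n (P : 'M[R]_n) : posdef P ->
  exists2 c : R, 0 < c & forall x, c * dot x x <= dot x (P *m x).
Proof.
move=> HP; have uP := posdef_unit HP.
pose C := \sum_i dot (invmx P *m delta_mx i 0) (P *m (invmx P *m delta_mx i 0 : 'cV_n)).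
have C0 : 0 <= C by apply: sumr_ge0 => i _; apply: posdef_ge0.
exists (1 + C)^-1; first by rewrite invr_gt0; lra.
move=> x; have qx := posdef_ge0 x HP.
rewrite ler_pdivrMl; last by lra.
suff : dot x x <= C * dot x (P *m x) by lra.
rewrite dotE mulr_suml; apply: ler_sum => i _.
have := posdef_CS (invmx P *m delta_mx i 0 : 'cV_n) x HP.
suff -> : dot (invmx P *m delta_mx i 0 : 'cV_n) (P *m x) = x i 0 by rewrite expr2.
rewrite dot_mulr posdef_sym // mulKVmx // dotE (bigD1 i) //= big1 ?addr0.
  by rewrite mxE !eqxx mul1r.
by move=> j ji; rewrite mxE (negPf ji) mul0r.
Qed.

Lemma qform_bound n (H : 'M[R]_n) :
  exists2 C : R, 0 <= C & forall x, dot x (H *m x) <= C * dot x x.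
Proof.
exists (\sum_i \sum_j `|H i j|); first by apply: sumr_ge0 => i _; apply: sumr_ge0.
move=> x; rewrite {1}dotE mulr_suml; apply: ler_sum => i _.
rewrite mxE mulr_sumr mulr_suml; apply: ler_sum => j _.
have le1 k : x k 0 ^+ 2 <= dot x x.
  rewrite dotE (bigD1 k) //= -expr2 lerDl sumr_ge0 // => l _.
  by rewrite -expr2 sqr_ge0.
apply: le_trans (ler_norm _) _; rewrite mulrCA normrM ler_wpM2l //.
have := le1 i; have := le1 j; rewrite normrM.
rewrite -(real_normK (num_real (x i 0))) -(real_normK (num_real (x j 0))).
have := sqr_ge0 (`|x i 0| - `|x j 0|); nra.
Qed.

(** With [- F] bounded below by [c], the radius keeps the perturbation within [c / 2 * |x|^2]; the
    bound 1 on [t] lets the quadratic term be estimated like the linear one. [H1] needs bounds on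
    both sides because [t] may be negative. *)
Lemma negdef_perturb n (F H1 H2 : 'M[R]_n) : negdef F -> H1^T = H1 -> H2^T = H2 ->
  exists2 e : R, 0 < e &
    forall t, `|t| < e -> negdef (F + t *: H1 + t ^+ 2 *: H2).
Proof.
move=> /posdefN HF s1 s2.
have [c c0 Hc] := posdef_coercive HF.
have [C1 C10 HC1] := qform_bound H1.
have [D1 D10 HD1] := qform_bound (- H1).
have [C2 C20 HC2] := qform_bound H2.
pose S := 1 + C1 + D1 + C2.
have S1 : 1 <= S by rewrite /S; lra.
exists (Num.min 1 (c / (2 * S))).
  by rewrite lt_min ltr01 divr_gt0 //; lra.
move=> t; rewrite lt_min => /andP[t1 t2].
have symF : F^T = F by have := posdef_sym HF; rewrite linearN => /oppr_inj.
split; first by rewrite !linearD !linearZ /= s1 s2 symF.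
move=> x x0; rewrite qformE !mulmxDl -!scalemxAl !dotS.
have := Hc x; rewrite mulNmx dotNr => Hcx.
have := HC1 x; have := HC2 x; have := HD1 x; rewrite mulNmx dotNr.
have := dot_gt0 x0; move: (dot x x) (dot x (H1 *m x)) (dot x (H2 *m x)) (dot x (F *m x)) Hcx.
move=> d h1 h2 f Hf d0 b1 b2 b3.
have at0 := normr_ge0 t.
have Hth1 : t * h1 <= `|t| * ((C1 + D1) * d).
  apply: le_trans (ler_norm _) _; rewrite normrM ler_wpM2l //.
  have := mulr_ge0 C10 (ltW d0); have := mulr_ge0 D10 (ltW d0) => *.
  by rewrite ler_norml; apply/andP; split; lra.
have Hth2 : t ^+ 2 * h2 <= `|t| * (C2 * d).
  have C2d := mulr_ge0 C20 (ltW d0).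
  apply: (@le_trans _ _ (t ^+ 2 * (C2 * d))); first by rewrite ler_wpM2l ?sqr_ge0.
  rewrite ler_wpM2r // -(real_normK (num_real t)) expr2 -[leRHS]mul1r ler_wpM2r //.
  exact: ltW.
have : `|t| * (S * d) <= c / 2 * d.
  rewrite mulrA ler_wpM2r ?ltW //.
  move: t2; rewrite ltr_pdivlMr; [lra|lra].
rewrite /S => Ht.
have : 0 <= `|t| * d by rewrite mulr_ge0 // ltW.
nra.
Qed.

End Dot.

(** * Performance inequality under congruence *)

Section Performance.
Variable R : realType.

Lemma perf_form_tr nx nl mp kp gamma (S : perf_sys R nx nl mp kp) X P :
  X^T = X -> P^T = P -> (perf_form gamma S X P)^T = perf_form gamma S X P.
Proof.
move=> sX sP; rewrite /perf_form !trmx_mul trmxK !mulmxA.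
by rewrite /perf_middle /antidiag !(tr_block_mx, trmx0, tr_scalar_mx) sX sP.
Qed.

Lemma perf_formE nx nl mp kp gamma (S : perf_sys R nx nl mp kp) X P
    (x : 'cV_nx) (l : 'cV_nl) (w : 'cV_mp) : X^T = X -> P^T = P ->
  let z := col_mx (col_mx x l) w in
  let y := pC1 S *m x + pC2 S *m l + pD S *m w in
  dot z (perf_form gamma S X P *m z) =
    2 * dot x (X *m (pA11 S *m x + pA12 S *m l + pB1 S *m w)) +
    2 * dot l (P *m (pA21 S *m x + pA22 S *m l + pB2 S *m w)) -
    gamma * dot w w + dot y y.
Proof.
move=> sX sP z y; rewrite /perf_form -!mulmxA dot_mulr trmxK.
have -> : perf_factor S *m z =
  col_mx (col_mx (col_mx x (pA11 S *m x + pA12 S *m l + pB1 S *m w))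
                 (col_mx l (pA21 S *m x + pA22 S *m l + pB2 S *m w))) (col_mx w y).
  by rewrite /perf_factor /z !mul_col_mx !mul_row_col !(mul0mx, mul1mx, addr0, add0r).
move: (pA11 S *m x + _ + _) (pA21 S *m x + _ + _) y => b a y.
rewrite /perf_middle /antidiag !(mul_block_col, mul0mx, addr0, add0r, mul1mx).
rewrite !dot_col mul_scalar_mx !dotS (dot_mulr b) sX (dotC (X *m b)).
by rewrite (dot_mulr a) sP (dotC (P *m a)); ring.
Qed.

(** [Y1] and [Y2] may be rectangular and rank deficient, so the claim only equates the values of two
    forms at related vectors. *)
Lemma perf_form_congr nx nl nx' nl' mp kp gamma (S : perf_sys R nx nl mp kp)
    (S' : perf_sys R nx' nl' mp kp) X P (Y1 : 'M_(nx, nx')) (Y2 : 'M_(nl, nl'))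
    (x : 'cV_nx') (l : 'cV_nl') (w : 'cV_mp) : X^T = X -> P^T = P ->
  pA11 S' = Y1^T *m X *m pA11 S *m Y1 -> pA12 S' = Y1^T *m X *m pA12 S *m Y2 ->
  pB1 S' = Y1^T *m X *m pB1 S ->
  pA21 S' = Y2^T *m P *m pA21 S *m Y1 -> pA22 S' = Y2^T *m P *m pA22 S *m Y2 ->
  pB2 S' = Y2^T *m P *m pB2 S ->
  pC1 S' = pC1 S *m Y1 -> pC2 S' = pC2 S *m Y2 -> pD S' = pD S ->
  let z' := col_mx (col_mx x l) w in
  let z := col_mx (col_mx (Y1 *m x) (Y2 *m l)) w in
  dot z' (perf_form gamma S' 1%:M 1%:M *m z') = dot z (perf_form gamma S X P *m z).
Proof.
move=> sX sP e11 e12 e1 e21 e22 e2 c1 c2 d z' z.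
rewrite !perf_formE ?trmx1 // e11 e12 e1 e21 e22 e2 c1 c2 d !mul1mx.
by rewrite -!mulmxA -!mulmxDr (dot_mulr x) (dot_mulr l) !trmxK.
Qed.

Lemma cl_blockE p pc q qc mp kp m k
    (A : 'M[R]_(p, q)) (Bp : 'M[R]_(p, mp)) (B : 'M[R]_(p, m))
    (Cp : 'M[R]_(kp, q)) (C : 'M[R]_(k, q))
    (Dp : 'M[R]_(kp, mp)) (E : 'M[R]_(kp, m)) (F : 'M[R]_(k, mp))
    (Ac : 'M[R]_(pc, qc)) (Bc : 'M[R]_(pc, k))
    (Cc : 'M[R]_(m, qc)) (Dc : 'M[R]_(m, k)) :
  cl_block A Bp B Cp C Dp E F Ac Bc Cc Dc =
  block_mx (block_mx (A + B *m Dc *m C) (B *m Cc) (Bc *m C) Ac)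
           (col_mx (Bp + B *m Dc *m F) (Bc *m F))
           (row_mx (Cp + E *m Dc *m C) (E *m Cc)) (Dp + E *m Dc *m F).
Proof.
rewrite /cl_block !mulmx_block !(mul0mx, mulmx0, add0r, addr0) !mul_col_mx !mul_mx_row.
rewrite !(mul0mx, mulmx0, add0r, addr0, mul1mx, mulmx1).
rewrite !(add_col_mx, add_row_mx, mul_col_mx, add0r, addr0) -block_mxEh.
by rewrite !(add_block_mx, add_col_mx, add_row_mx, add0r, addr0).
Qed.

Lemma syn_blockE p p' q q' mp kp m k
    (A : 'M[R]_(p, q)) (Bp : 'M[R]_(p, mp)) (B : 'M[R]_(p, m))
    (Cp : 'M[R]_(kp, q)) (C : 'M[R]_(k, q))
    (Dp : 'M[R]_(kp, mp)) (E : 'M[R]_(kp, m)) (F : 'M[R]_(k, mp))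
    (X : 'M[R]_(p, p')) (Y : 'M[R]_(q, q'))
    (K : 'M[R]_(p', q')) (L : 'M[R]_(p', k))
    (M : 'M[R]_(m, q')) (N : 'M[R]_(m, k)) :
  syn_block A Bp B Cp C Dp E F X Y K L M N =
  block_mx (block_mx (A *m Y + B *m M) (A + B *m N *m C) K (X^T *m A + L *m C))
           (col_mx (Bp + B *m N *m F) (X^T *m Bp + L *m F))
           (row_mx (Cp *m Y + E *m M) (Cp + E *m N *m C)) (Dp + E *m N *m F).
Proof.
rewrite /syn_block !mulmx_block !(mul0mx, mulmx0, add0r, addr0) !mul_col_mx !mul_mx_row.
rewrite !(mul0mx, mulmx0, add0r, addr0, mul1mx, mulmx1).
rewrite !(add_col_mx, add_row_mx, mul_col_mx, add0r, addr0) -block_mxEh.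
by rewrite !(add_block_mx, add_col_mx, add_row_mx, add0r, addr0).
Qed.

(* The controller parameters enter the transformed closed loop only through
   [K L; M N] = [U X^T B; 0 I] [Ac Bc; Cc Dc] [Z 0; C Y I] + [X^T A Y 0; 0 0]. *)
Definition trK p pc q qc m k p' q' (A : 'M[R]_(p, q)) (B : 'M[R]_(p, m)) (C : 'M[R]_(k, q))
    (X : 'M[R]_(p, p')) (Y : 'M[R]_(q, q')) (U : 'M[R]_(p', pc)) (Z : 'M[R]_(qc, q'))
    (Ac : 'M[R]_(pc, qc)) (Bc : 'M[R]_(pc, k)) (Cc : 'M[R]_(m, qc)) (Dc : 'M[R]_(m, k)) :=
  X^T *m A *m Y + U *m Ac *m Z + X^T *m B *m Cc *m Z + U *m Bc *m C *m Y
  + X^T *m B *m Dc *m C *m Y.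
Definition trL p pc m k p' (B : 'M[R]_(p, m)) (X : 'M[R]_(p, p')) (U : 'M[R]_(p', pc))
    (Bc : 'M[R]_(pc, k)) (Dc : 'M[R]_(m, k)) :=
  U *m Bc + X^T *m B *m Dc.
Definition trM q qc m k q' (C : 'M[R]_(k, q)) (Y : 'M[R]_(q, q')) (Z : 'M[R]_(qc, q'))
    (Cc : 'M[R]_(m, qc)) (Dc : 'M[R]_(m, k)) :=
  Cc *m Z + Dc *m C *m Y.

Section Transformation.
Variables (p pc q qc mp kp m k p' q' : nat).
Variables (A : 'M[R]_(p, q)) (Bp : 'M[R]_(p, mp)) (B : 'M[R]_(p, m)).
Variables (Cp : 'M[R]_(kp, q)) (C : 'M[R]_(k, q)).
Variables (Dp : 'M[R]_(kp, mp)) (E : 'M[R]_(kp, m)) (F : 'M[R]_(k, mp)).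
Variables (Ac : 'M[R]_(pc, qc)) (Bc : 'M[R]_(pc, k)).
Variables (Cc : 'M[R]_(m, qc)) (Dc : 'M[R]_(m, k)).
Variables (X : 'M[R]_(p, p')) (Y : 'M[R]_(q, q')) (U : 'M[R]_(p', pc)) (Z : 'M[R]_(qc, q')).
Let cl := cl_block A Bp B Cp C Dp E F Ac Bc Cc Dc.
Let syn := syn_block A Bp B Cp C Dp E F X Y (trK A B C X Y U Z Ac Bc Cc Dc)
  (trL B X U Bc Dc) (trM C Y Z Cc Dc) Dc.
Let XX := block_mx 1%:M 0 X^T U : 'M_(p + p', p + pc).
Let YY := block_mx Y 1%:M Z 0 : 'M_(q + qc, q' + q).

(** Here [XX] plays the role of [T^T X] and [YY] that of [T]; multiplying the closed-loop blocks by
    them regroups all controller terms into [trK], [trL] and [trM]. *)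
Lemma syn_ul : ulsubmx syn = XX *m ulsubmx cl *m YY.
Proof.
rewrite /syn /cl syn_blockE cl_blockE !block_mxKul /XX /YY !mulmx_block.
rewrite !(mul1mx, mul0mx, mulmx1, mulmx0, add0r, addr0) /trK /trL /trM.
congr block_mx.
- by rewrite mulmxDr mulmxDl !mulmxA -addrA (addrC (_ *m Z)).
- rewrite !(mulmxDl, mulmxDr) !mulmxA -!addrA; congr (_ + _).
  by rewrite addrC [X in X + _]addrC [X in X + _ + _]addrC -!addrA.
- by rewrite !(mulmxDl, mulmxDr) !mulmxA -addrA (addrC (U *m _ *m _)).
Qed.

Lemma syn_ur : ursubmx syn = XX *m ursubmx cl.
Proof.
rewrite /syn /cl syn_blockE cl_blockE !block_mxKur /XX mul_block_col.
by rewrite mul1mx mul0mx addr0 /trL !(mulmxDr, mulmxDl) !mulmxA -addrA (addrC (U *m _ *m _)).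
Qed.

Lemma syn_dl : dlsubmx syn = dlsubmx cl *m YY.
Proof.
rewrite /syn /cl syn_blockE cl_blockE !block_mxKdl /YY mul_row_block.
by rewrite mulmx1 mulmx0 addr0 /trM !(mulmxDr, mulmxDl) !mulmxA -addrA (addrC (_ *m Z)).
Qed.

Lemma syn_dr : drsubmx syn = drsubmx cl.
Proof. by rewrite /syn /cl syn_blockE cl_blockE !block_mxKdr. Qed.

End Transformation.

End Performance.

Section Synthesis.
Variable R : realType.
Variables (n1 n2 l mp kp m1 m2 k1 k2 : nat).
Notation n := (n1 + n2)%N.
Notation m := (m1 + m2)%N.
Notation k := (k1 + k2)%N.
Implicit Types (G : plant R n l l mp kp m k) (v : lyap_vars R n1 n2).
Implicit Types (c : ctrl_vars R n l m k).

Lemma row_cast_mul q q' (J : 'M[R]_(n + (n + n), q)) (M : 'M[R]_(q, q')) :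
  row_cast J *m M = row_cast (J *m M).
Proof. by rewrite /row_cast; case: _ / (addnA _ _ _); rewrite !castmx_id. Qed.

Lemma row_cast_col q (a b c : 'M[R]_(n, q)) :
  row_cast (col_mx a (col_mx b c)) = col_mx (col_mx a b) c.
Proof. by rewrite col_mxA /row_cast castmx_comp castmx_id. Qed.

(** The interface shared by both directions: solved for [K] when a controller is reconstructed, and
    for [c] when a controller is given. *)
Record same_ctrl r s nc lc (G : plant R n l l mp kp m k)
    (K : controller R r s nc lc lc m k) v (X2 Y2 : 'M[R]_l) c
    (U1 : 'M[R]_(n + n, nc)) (Z1 : 'M[R]_(nc, n + n))
    (U2 : 'M[R]_(l, lc)) (Z2 : 'M[R]_(lc, l)) : Prop := SameCtrl {
  scK11 : synK11 G v c = trK (gA11 G) (gB1 G) (gC1 G) (lyX1 v) (lyY1 v) U1 Z1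
    (cA11 K) (cB1 K) (cC1 K) (cD K);
  scK12 : synK12 c = trK (gA12 G) (gB1 G) (gC2 G) (lyX1 v) Y2 U1 Z2
    (cA12 K) (cB1 K) (cC2 K) (cD K);
  scK21 : synK21 G v X2 c = trK (gA21 G) (gB2 G) (gC1 G) X2 (lyY1 v) U2 Z1
    (cA21 K) (cB2 K) (cC1 K) (cD K);
  scK22 : synK22 c = trK (gA22 G) (gB2 G) (gC2 G) X2 Y2 U2 Z2
    (cA22 K) (cB2 K) (cC2 K) (cD K);
  scL1 : synL1 G c = trL (gB1 G) (lyX1 v) U1 (cB1 K) (cD K);
  scL2 : synL2 c = trL (gB2 G) X2 U2 (cB2 K) (cD K);
  scM1 : synM1 G c = trM (gC1 G) (lyY1 v) Z1 (cC1 K) (cD K);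
  scM2 : synM2 c = trM (gC2 G) Y2 Z2 (cC2 K) (cD K);
  scN : synN c = cD K }.

Lemma syn_sys_form r s nc lc gamma (G : plant R n l l mp kp m k)
    (K : controller R r s nc lc lc m k) v (X2 Y2 : 'M[R]_l) c U1 Z1 U2 Z2 X P :
  let T1 := block_mx (lyY1 v) 1%:M Z1 0 in
  let T2 := block_mx Y2 1%:M Z2 0 in
  X^T = X -> P^T = P ->
  T1^T *m X = row_cast (block_mx 1%:M 0 (lyX1 v)^T U1) ->
  T2^T *m P = block_mx 1%:M 0 X2^T U2 ->
  same_ctrl G K v X2 Y2 c U1 Z1 U2 Z2 ->
  forall x y w,
  let z' := col_mx (col_mx x y) w in
  let z := col_mx (col_mx (T1 *m x) (T2 *m y)) w in
  dot z' (perf_form gamma (syn_sys G v X2 Y2 c) 1%:M 1%:M *m z') =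
  dot z (perf_form gamma (closed_loop G K) X P *m z).
Proof.
move=> T1 T2 sX sP hX hP [k11 k12 k21 k22 l1 l2 m1' m2' n0] x y w z' z.
apply: perf_form_congr => //=;
  rewrite ?hX ?hP ?row_cast_mul ?k11 ?k12 ?k21 ?k22 ?l1 ?l2 ?m1' ?m2' ?n0
    ?syn_ul ?syn_ur ?syn_dl ?syn_dr -?mulmxA //.
Qed.

End Synthesis.

(** * Triangular structure of the transformed controller *)

Section Structure.
Variable R : realType.

Lemma ursubmx_mul a1 a2 p b1 b2 (A : 'M[R]_(a1 + a2, p)) (B : 'M[R]_(p, b1 + b2)) :
  ursubmx (A *m B) = usubmx A *m rsubmx B.
Proof. by rewrite /ursubmx -mul_usub_mx -mulmx_rsub. Qed.

Lemma usub_rsub a1 a2 b1 b2 (J : 'M[R]_(a1 + a2, b1 + b2)) : usubmx (rsubmx J) = ursubmx J.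
Proof. by apply/matrixP => i j; rewrite !mxE. Qed.

Lemma dsub_rsub a1 a2 b1 b2 (J : 'M[R]_(a1 + a2, b1 + b2)) : dsubmx (rsubmx J) = drsubmx J.
Proof. by apply/matrixP => i j; rewrite !mxE. Qed.

Lemma ursubmxD a1 a2 b1 b2 (J J' : 'M[R]_(a1 + a2, b1 + b2)) :
  ursubmx (J + J') = ursubmx J + ursubmx J'.
Proof. by apply/matrixP => i j; rewrite !mxE. Qed.

Lemma ursubmxN a1 a2 b1 b2 (J : 'M[R]_(a1 + a2, b1 + b2)) : ursubmx (- J) = - ursubmx J.
Proof. by apply/matrixP => i j; rewrite !mxE. Qed.

Lemma rsubmxD a b1 b2 (J J' : 'M[R]_(a, b1 + b2)) : rsubmx (J + J') = rsubmx J + rsubmx J'.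
Proof. by apply/matrixP => i j; rewrite !mxE. Qed.

Lemma rsubmxN a b1 b2 (J : 'M[R]_(a, b1 + b2)) : rsubmx (- J) = - rsubmx J.
Proof. by apply/matrixP => i j; rewrite !mxE. Qed.

Lemma lower_btriP a1 a2 b1 b2 (J : 'M[R]_(a1 + a2, b1 + b2)) :
  lower_btri J -> J = block_mx (ulsubmx J) 0 (dlsubmx J) (drsubmx J).
Proof. by move=> J0; rewrite -[J in LHS]submxK J0. Qed.

Lemma lower_btri_mul a1 a2 b1 b2 c1 c2 (J : 'M[R]_(a1 + a2, b1 + b2))
    (J' : 'M[R]_(b1 + b2, c1 + c2)) :
  lower_btri J -> lower_btri J' -> lower_btri (J *m J').
Proof.
move=> /lower_btriP-> /lower_btriP->.
by rewrite /lower_btri mulmx_block block_mxKur mulmx0 mul0mx addr0.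
Qed.

(** The upper right block of [J J^-1 = 1] says that [J11] annihilates that of [J^-1], and [J11] is
    invertible because the determinant factors. *)
Lemma lower_btri_inv a1 a2 (J : 'M[R]_(a1 + a2)) :
  J \in unitmx -> lower_btri J -> lower_btri (invmx J).
Proof.
move=> uJ lJ; have := mulmxV uJ; rewrite {1}(lower_btriP lJ) -[invmx J]submxK.
rewrite mulmx_block scalar_mx_block => /eq_block_mx[_ e _ _].
rewrite mul0mx addr0 in e; rewrite /lower_btri block_mxKur; apply: (unitmx_inj _ e).
by move: uJ; rewrite {1}(lower_btriP lJ) !unitmxE det_lblock unitrM => /andP[].
Qed.

Lemma lower_btri_block a1 a2 b1 b2 (A : 'M[R]_(a1, b1)) (B : 'M[R]_(a2, b1)) (C : 'M[R]_(a2, b2)) :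
  lower_btri (block_mx A 0 B C).
Proof. by rewrite /lower_btri block_mxKur. Qed.

Lemma projU_lower a1 a2 b1 b2 (J J' : 'M[R]_(a1 + a2, b1 + b2)) :
  ursubmx J = ursubmx J' <-> lower_btri (J - projU J').
Proof.
rewrite /lower_btri -[J in J - _]submxK /projU opp_block_mx add_block_mx block_mxKur.
by split=> [->|/eqP]; [rewrite subrr | rewrite subr_eq0 => /eqP].
Qed.

Variables (n1 n2 l mp kp m1 m2 k1 k2 : nat).
Notation n := (n1 + n2)%N.
Notation m := (m1 + m2)%N.
Notation k := (k1 + k2)%N.
Variables (G : plant R n l l mp kp m k) (v : lyap_vars R n1 n2).
Hypothesis lB1 : lower_btri (gB1 G).
Hypothesis lC1 : lower_btri (gC1 G).

(** The last block column of [S2^T] is [(0; 1)] and that of [B1] has zero upper part. This and the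
    dual fact on [C1 T2] remove the Lyapunov variables from the prescribed blocks. *)
Lemma rsub_S2B1 : rsubmx ((lyS2 v)^T *m gB1 G) = rsubmx (gB1 G).
Proof.
rewrite (lower_btriP lB1) /lyS2 tr_block_mx trmxK trmx1 trmx0 mulmx_block.
by rewrite !block_mxEh !row_mxKr !mulmx0 mul0mx mul1mx addr0 add0r.
Qed.

Lemma usub_C1T2 : usubmx (gC1 G *m lyT2 v) = usubmx (gC1 G).
Proof.
rewrite (lower_btriP lC1) /lyT2 mulmx_block.
by rewrite !block_mxEv !col_mxKu !mulmx0 !mul0mx mulmx1 !addr0.
Qed.

Lemma usub_X1 p (J : 'M[R]_(n, p)) : usubmx ((lyX1 v)^T *m J) = (lyS2 v)^T *m J.
Proof. by rewrite /lyX1 tr_row_mx mul_col_mx col_mxKu. Qed.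

Lemma rsub_Y1 p (J : 'M[R]_(p, n)) : rsubmx (J *m lyY1 v) = J *m lyT2 v.
Proof. by rewrite /lyY1 mul_mx_row row_mxKr. Qed.

Lemma usub_B1e p (J : 'M[R]_(m, p)) : usubmx (synB1e G *m J) = rsubmx (gB1 G) *m dsubmx J.
Proof.
by rewrite /synB1e -{1}[J]vsubmxK mul_block_col col_mxKu mul0mx add0r.
Qed.

Lemma rsub_C1e p (J : 'M[R]_(p, k)) : rsubmx (J *m synC1e G) = lsubmx J *m usubmx (gC1 G).
Proof.
by rewrite /synC1e -{1}[J]hsubmxK mul_row_block row_mxKr mulmx0 addr0.
Qed.

Lemma ur_B1e p1 p2 (J : 'M[R]_(m, p1 + p2)) :
  ursubmx (synB1e G *m J) = rsubmx (gB1 G) *m drsubmx J.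
Proof. by rewrite -usub_rsub -mulmx_rsub usub_B1e dsub_rsub. Qed.

Lemma ur_C1e p1 p2 (J : 'M[R]_(p1 + p2, k)) :
  ursubmx (J *m synC1e G) = ulsubmx J *m usubmx (gC1 G).
Proof. by rewrite /ursubmx -mul_usub_mx rsub_C1e. Qed.

Lemma ur_X1B1 p1 p2 (J : 'M[R]_(m, p1 + p2)) :
  ursubmx ((lyX1 v)^T *m gB1 G *m J) =
  lsubmx ((lyS2 v)^T *m gB1 G) *m ursubmx J + rsubmx (gB1 G) *m drsubmx J.
Proof.
rewrite ursubmx_mul usub_X1 -[(lyS2 v)^T *m _]hsubmxK rsub_S2B1 row_mxKl.
by rewrite -[rsubmx J]vsubmxK mul_row_col usub_rsub dsub_rsub.
Qed.

Lemma ur_C1Y1 p1 p2 (J : 'M[R]_(p1 + p2, k)) :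
  ursubmx (J *m gC1 G *m lyY1 v) =
  ulsubmx J *m usubmx (gC1 G) + ursubmx J *m dsubmx (gC1 G *m lyT2 v).
Proof.
rewrite -mulmxA ursubmx_mul rsub_Y1 -[gC1 G *m lyT2 v]vsubmxK usub_C1T2 col_mxKd.
by rewrite -[usubmx J]hsubmxK mul_row_col.
Qed.

Lemma ur_X1B1_lower (N : 'M[R]_(m, k)) : lower_btri N ->
  ursubmx ((lyX1 v)^T *m gB1 G *m N) = ursubmx (synB1e G *m N).
Proof.
move=> lN; rewrite ur_X1B1 lN mulmx0 add0r.
by rewrite /ursubmx usub_B1e -mulmx_rsub.
Qed.

Lemma ur_C1Y1_lower (N : 'M[R]_(m, k)) : lower_btri N ->
  ursubmx (N *m gC1 G *m lyY1 v) = ursubmx (N *m synC1e G).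
Proof.
move=> lN; rewrite ur_C1Y1 lN mul0mx addr0.
by rewrite /ursubmx -mul_usub_mx rsub_C1e.
Qed.

(** The upper right blocks of [synM1] and [synL1] are those of [N C1e] and [B1e N]. Hence the terms
    with [lsubmx (S2^T B1)] and those with [dsubmx (C1 T2)], which depend on the Lyapunov variables,
    cancel in pairs. *)
Lemma ur_synK11 (c : ctrl_vars R n l m k) :
  lower_btri (vL1 c) -> lower_btri (vM1 c) -> lower_btri (vN c) ->
  ursubmx ((lyX1 v)^T *m gB1 G *m synM1 G c + synL1 G c *m gC1 G *m lyY1 v
           - (lyX1 v)^T *m gB1 G *m vN c *m gC1 G *m lyY1 v) =
  ursubmx (synB1e G *m vM1 c) + ursubmx (vL1 c *m synC1e G)
  - ursubmx (synB1e G *m vN c *m synC1e G).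
Proof.
move=> lL lM lN; rewrite !(ursubmxD, ursubmxN) ur_C1Y1 -(mulmxA _ (vN c)) -(mulmxA _ (vN c *m _)).
rewrite !ur_X1B1 ur_C1Y1_lower //.
have -> : drsubmx (vN c *m gC1 G *m lyY1 v) =
    dlsubmx (vN c) *m usubmx (gC1 G) + drsubmx (vN c) *m dsubmx (gC1 G *m lyT2 v).
  rewrite -mulmxA -[LHS]dsub_rsub -mulmx_rsub rsub_Y1.
  rewrite -{1}[gC1 G *m lyT2 v]vsubmxK usub_C1T2 -{1}[vN c]submxK.
  by rewrite mul_block_col col_mxKd.
have eM : ursubmx (synM1 G c) = ursubmx (vN c *m synC1e G).
  by rewrite /synM1 /projU ursubmxD lM add0r block_mxKur.
have eM' : drsubmx (synM1 G c) = drsubmx (vM1 c).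
  by rewrite /synM1 /projU -[vM1 c in LHS]submxK add_block_mx block_mxKdr addr0.
have eL : ursubmx (synL1 G c) = rsubmx (gB1 G) *m drsubmx (vN c).
  by rewrite /synL1 /projU ursubmxD lL add0r block_mxKur ur_B1e.
have eL' : ulsubmx (synL1 G c) = ulsubmx (vL1 c).
  by rewrite /synL1 /projU -[vL1 c in LHS]submxK add_block_mx block_mxKul addr0.
rewrite eM eM' eL eL' -(mulmxA (synB1e G)) !ur_B1e !ur_C1e.
have -> : drsubmx (vN c *m synC1e G) = dlsubmx (vN c) *m usubmx (gC1 G).
  by rewrite /drsubmx -mul_dsub_mx rsub_C1e.
rewrite !mulmxDr !mulmxA.
set a := _ *m _ *m _; set b := _ *m drsubmx (vM1 c); set d := ulsubmx _ *m _.
set f := _ *m dsubmx _; set e := _ *m dlsubmx _ *m _.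
by move: a b d e f => a b d e f; apply/matrixP => i j; rewrite !mxE; ring.
Qed.

Hypothesis cB2 : last_cols0 (gB2 G).

Lemma rs_B2 p1 p2 p3 (J : 'M[R]_(p1, l)) (J' : 'M[R]_(m, p2 + p3)) :
  rsubmx (J *m gB2 G *m J') = J *m lsubmx (gB2 G) *m ursubmx J'.
Proof.
rewrite -mulmx_rsub -usub_rsub -[rsubmx J' in LHS]vsubmxK.
by rewrite -[gB2 G in LHS]hsubmxK cB2 mul_mx_row mul_row_col mulmx0 mul0mx addr0.
Qed.

(** The zero columns of [B2] leave only the upper right blocks of [synM1] and [N C1 Y1], which agree
    and cancel; the zero columns of [L2] leave only the first rows of [C1 T2], which are those of
    [C1]. *)
Lemma rs_synK21 (X2 : 'M[R]_l) (c : ctrl_vars R n l m k) :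
  last_cols0 (vL2 c) -> lower_btri (vM1 c) -> lower_btri (vN c) ->
  rsubmx (X2^T *m gB2 G *m synM1 G c + vL2 c *m gC1 G *m lyY1 v
           - X2^T *m gB2 G *m vN c *m gC1 G *m lyY1 v) = rsubmx (vL2 c *m synC1e G).
Proof.
move=> cL lM lN; rewrite rsubmxD rsubmxD rsubmxN -(mulmxA _ (vN c)) -(mulmxA _ (vN c *m _)).
rewrite !rs_B2 ur_C1Y1_lower //.
have -> : ursubmx (synM1 G c) = ursubmx (vN c *m synC1e G).
  by rewrite /synM1 /projU ursubmxD lM add0r block_mxKur.
rewrite addrC addKr -(mulmxA (vL2 c)) -[LHS]mulmx_rsub rsub_Y1.
rewrite -{1}[gC1 G *m lyT2 v]vsubmxK usub_C1T2.
by rewrite rsub_C1e -{1}[vL2 c]hsubmxK cL mul_row_col mul0mx addr0.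
Qed.
End Structure.

(** * Scaling classes and the lifted scheduling matrix *)

Section Scalings.
Variable R : realType.

Lemma dot_col_congr n p (T : 'M[R]_(n, p)) (P : 'M[R]_n) (x : 'cV_p) :
  dot x (T^T *m P *m T *m x) = dot (T *m x) (P *m (T *m x)).
Proof. by rewrite -!mulmxA dot_mulr trmxK. Qed.

Lemma negdef_congrE n p (T : 'M[R]_(n, p)) (P : 'M[R]_n) : P^T = P ->
  negdef (T^T *m P *m T) <-> forall x, x != 0 -> dot (T *m x) (P *m (T *m x)) < 0.
Proof.
move=> sP; split=> [[_ H] x /H|H]; first by rewrite qformE dot_col_congr.
split; first by rewrite !trmx_mul trmxK sP mulmxA.
by move=> x /H; rewrite qformE dot_col_congr.
Qed.

Lemma posdef_congrE n p (T : 'M[R]_(n, p)) (P : 'M[R]_n) : P^T = P ->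
  posdef (T^T *m P *m T) <-> forall x, x != 0 -> 0 < dot (T *m x) (P *m (T *m x)).
Proof.
move=> sP; split=> [[_ H] x /H|H]; first by rewrite qformE dot_col_congr.
split; first by rewrite !trmx_mul trmxK sP mulmxA.
by move=> x /H; rewrite qformE dot_col_congr.
Qed.

Lemma scaling_posdefE p (P D : 'M[R]_p) : P^T = P ->
  posdef ((col_mx D 1%:M)^T *m antidiag P *m col_mx D 1%:M) <->
  forall x, x != 0 -> 0 < dot x (P *m (D *m x)).
Proof.
move=> sP; rewrite posdef_congrE; last by rewrite /antidiag tr_block_mx !trmx0 sP.
have e x : dot (col_mx D 1%:M *m x) (antidiag P *m (col_mx D 1%:M *m x)) =
    dot x (P *m (D *m x)) *+ 2.
  rewrite mul_col_mx mul1mx /antidiag mul_block_col !mul0mx add0r addr0 dot_col.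
  by rewrite (dot_mulr (D *m x)) sP dotC mulr2n.
by split=> H x /H; rewrite e pmulrn_lgt0.
Qed.

Lemma involution_form p (X L : 'M[R]_p) (u w : 'cV_p) : X^T = X ->
  L *m u = u -> L *m w = - w ->
  dot (u + w) (X *m (L *m (u + w))) = dot u (X *m u) - dot w (X *m w).
Proof.
move=> sX Lu Lw; rewrite mulmxDr Lu Lw mulmxDr mulmxN !dotS.
by rewrite (dot_mulr w) sX (dotC _ u); ring.
Qed.

Lemma lift_Delta_col r s (D : 'M[R]_(r, s)) (a : 'cV_r) (b : 'cV_s) :
  lift_Delta D *m col_mx a b = col_mx (2 *: (D *m b) - a) b.
Proof.
by rewrite /lift_Delta mul_block_col mulNmx !mul1mx mul0mx add0r -scalemxAl addrC.
Qed.

Lemma lift_Delta_tr_col r s (D : 'M[R]_(r, s)) (a : 'cV_r) (b : 'cV_s) :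
  (lift_Delta D)^T *m col_mx a b = col_mx (- a) (2 *: (D^T *m a) + b).
Proof.
rewrite /lift_Delta tr_block_mx mul_block_col !linearN linearZ /= !trmx1 !trmx0.
by rewrite mulNmx !mul1mx mul0mx addr0 -scalemxAl.
Qed.

Lemma scale2E (V : lmodType R) (x : V) : 2 *: x = x + x.
Proof. by rewrite scaler_nat mulr2n. Qed.

(* [lift_Delta D] is an involution with eigenspaces [{(D y, y)}] (for 1) and
   [{(d, 0)}] (for -1); splitting [x] along them diagonalises the form. *)
Lemma classPp_lift r s (V : set 'M[R]_(r, s)) (X : 'M[R]_(r + s)) : V 0 ->
  classPp V X <-> X^T = X /\
    forall D, V D -> forall x, x != 0 -> 0 < dot x (X *m (lift_Delta D *m x)).
Proof.
move=> V0.
have Lp (D : 'M[R]_(r, s)) (y : 'cV_s) : lift_Delta D *m col_mx (D *m y) y = col_mx (D *m y) y.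
  by rewrite lift_Delta_col scale2E addrK.
have Lm (D : 'M[R]_(r, s)) (d : 'cV_r) : lift_Delta D *m col_mx d 0 = - col_mx d 0.
  by rewrite lift_Delta_col mulmx0 scaler0 add0r opp_col_mx oppr0.
split=> [[sX /(negdef_congrE _ sX) Hn Hp]|[sX H]].
  split=> // D VD x; have {}Hp := (posdef_congrE _ sX).1 (Hp _ VD).
  rewrite -[x]vsubmxK; move: (dsubmx x) (usubmx x) => y a.
  have -> : col_mx a y = col_mx (D *m y) y + col_mx (a - D *m y) 0.
    by rewrite add_col_mx addr0 addrC subrK.
  move: (a - _) => d x0; rewrite involution_form //.
  have := Hp y; have := Hn d; rewrite !mul_col_mx !mul1mx mul0mx.
  have [d0|d0] := eqVneq d 0; have [y0|y0] := eqVneq y 0.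
  - by move: x0; rewrite y0 d0 mulmx0 col_mx0 addr0 eqxx.
  - by move=> _ /(_ isT); rewrite d0 col_mx0 dot0l subr0.
  - by move=> /(_ isT) H _; rewrite y0 mulmx0 col_mx0 dot0l sub0r oppr_gt0.
  - by move=> /(_ isT) h1 /(_ isT) h2; rewrite subr_gt0 (lt_trans h1).
split=> //.
  apply/negdef_congrE => // d d0; rewrite mul_col_mx mul1mx mul0mx.
  have /(H _ V0) : col_mx d 0 != 0 :> 'cV_(r + s).
    by apply: contra_neq d0; rewrite -(col_mx0 _ r s 1) => /eq_col_mx[].
  by rewrite Lm mulmxN dotNr oppr_gt0.
move=> D VD; apply/posdef_congrE => // y y0; rewrite mul_col_mx mul1mx.
have /(H _ VD) : col_mx (D *m y) y != 0.
  by apply: contra_neq y0; rewrite -(col_mx0 _ r s 1) => /eq_col_mx[].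
by rewrite Lp.
Qed.

(** The same splitting for the transpose, which fixes [{(0, y)}] and negates [{(d, - D^T d)}]. The
    fixed space does not depend on [D], so its condition is recovered from the single point 0 of
    [V]. *)
Lemma classPd_lift r s (V : set 'M[R]_(r, s)) (Y : 'M[R]_(r + s)) : V 0 ->
  classPd V Y <-> Y^T = Y /\
    forall D, V D -> forall x, x != 0 -> 0 < dot x (lift_Delta D *m (Y *m x)).
Proof.
move=> V0.
have Lp (D : 'M[R]_(r, s)) (y : 'cV_s) : (lift_Delta D)^T *m col_mx 0 y = col_mx 0 y.
  by rewrite lift_Delta_tr_col mulmx0 scaler0 add0r oppr0.
have Lm (D : 'M[R]_(r, s)) (d : 'cV_r) :
    (lift_Delta D)^T *m col_mx d (- D^T *m d) = - col_mx d (- D^T *m d).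
  by rewrite lift_Delta_tr_col mulNmx scale2E addrK opp_col_mx opprK.
have swap D x : Y^T = Y ->
    dot x (lift_Delta D *m (Y *m x)) = dot x (Y *m ((lift_Delta D)^T *m x)).
  by move=> sY; rewrite [RHS]dot_mulr sY [RHS]dot_mulr trmxK dotC.
split=> [[sY /(posdef_congrE _ sY) Hn Hp]|[sY H]].
  split=> // D VD x; have {}Hp := (negdef_congrE _ sY).1 (Hp _ VD).
  rewrite swap // -[x]vsubmxK; move: (dsubmx x) (usubmx x) => y d.
  have -> : col_mx d y = col_mx 0 (y + D^T *m d) + col_mx d (- D^T *m d).
    by rewrite add_col_mx add0r mulNmx addrK.
  move: (y + _) => {}y x0; rewrite involution_form //.
  have := Hp d; have := Hn y; rewrite !mul_col_mx !mul1mx mul0mx.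
  have [d0|d0] := eqVneq d 0; have [y0|y0] := eqVneq y 0.
  - by move: x0; rewrite y0 d0 mulmx0 col_mx0 addr0 eqxx.
  - by move=> /(_ isT) h _; rewrite d0 mulmx0 col_mx0 dot0l subr0.
  - by move=> _ /(_ isT) h; rewrite y0 col_mx0 dot0l sub0r oppr_gt0.
  - by move=> /(_ isT) h1 /(_ isT) h2; rewrite subr_gt0 (lt_trans h2).
split=> //.
  apply/posdef_congrE => // d d0; rewrite mul_col_mx mul1mx mul0mx.
  have /(H _ V0) : col_mx 0 d != 0 :> 'cV_(r + s).
    by apply: contra_neq d0; rewrite -(col_mx0 _ r s 1) => /eq_col_mx[].
  by rewrite swap // Lp.
move=> D VD; apply/negdef_congrE => // y y0; rewrite mul_col_mx mul1mx.
have /(H _ VD) : col_mx y (- D^T *m y) != 0.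
  by apply: contra_neq y0; rewrite -(col_mx0 _ r s 1) => /eq_col_mx[].
by rewrite swap // Lm mulmxN dotNr oppr_gt0.
Qed.

End Scalings.

(** * Perturbation of parameters *)

Section Affine.
Variable R : realType.

Definition aff p q (f : R -> 'M[R]_(p, q)) :=
  exists A B, forall t, f t = A + t *: B.

Lemma aff_const p q (A : 'M[R]_(p, q)) : aff (fun=> A).
Proof. by exists A, 0 => t; rewrite scaler0 addr0. Qed.

Lemma aff_scalar p : aff (fun t => t%:M : 'M_p).
Proof. by exists 0, 1%:M => t; rewrite add0r scalemx1. Qed.

Lemma affD p q (f g : R -> 'M[R]_(p, q)) : aff f -> aff g -> aff (fun t => f t + g t).
Proof.
move=> [A [B e]] [A' [B' e']]; exists (A + A'), (B + B') => t.
by rewrite e e' scalerDr addrACA.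
Qed.

Lemma affN p q (f : R -> 'M[R]_(p, q)) : aff f -> aff (fun t => - f t).
Proof.
by move=> [A [B e]]; exists (- A), (- B) => t; rewrite e opprD scalerN.
Qed.

Lemma affMl p q q' (A : 'M[R]_(p, q)) (f : R -> 'M[R]_(q, q')) : aff f -> aff (fun t => A *m f t).
Proof.
by move=> [B [B' e]]; exists (A *m B), (A *m B') => t; rewrite e mulmxDr scalemxAr.
Qed.

Lemma affMr p q q' (A : 'M[R]_(q, q')) (f : R -> 'M[R]_(p, q)) : aff f -> aff (fun t => f t *m A).
Proof.
by move=> [B [B' e]]; exists (B *m A), (B' *m A) => t; rewrite e mulmxDl scalemxAl.
Qed.

Lemma aff_tr p q (f : R -> 'M[R]_(p, q)) : aff f -> aff (fun t => (f t)^T).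
Proof.
by move=> [A [B e]]; exists A^T, B^T => t; rewrite e linearD linearZ.
Qed.

Lemma aff_row p q q' (f : R -> 'M[R]_(p, q)) (g : R -> 'M[R]_(p, q')) :
  aff f -> aff g -> aff (fun t => row_mx (f t) (g t)).
Proof.
move=> [A [B e]] [A' [B' e']]; exists (row_mx A A'), (row_mx B B') => t.
by rewrite e e' scale_row_mx add_row_mx.
Qed.

Lemma aff_col p p' q (f : R -> 'M[R]_(p, q)) (g : R -> 'M[R]_(p', q)) :
  aff f -> aff g -> aff (fun t => col_mx (f t) (g t)).
Proof.
move=> [A [B e]] [A' [B' e']]; exists (col_mx A A'), (col_mx B B') => t.
by rewrite e e' scale_col_mx add_col_mx.
Qed.

Lemma aff_block p p' q q' (f : R -> 'M[R]_(p, q)) (g : R -> 'M[R]_(p, q'))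
    (h : R -> 'M[R]_(p', q)) (k : R -> 'M[R]_(p', q')) :
  aff f -> aff g -> aff h -> aff k -> aff (fun t => block_mx (f t) (g t) (h t) (k t)).
Proof. by move=> *; apply: aff_col; apply: aff_row. Qed.

Lemma aff_rsub p q q' (f : R -> 'M[R]_(p, q + q')) : aff f -> aff (fun t => rsubmx (f t)).
Proof.
move=> [A [B e]]; exists (rsubmx A), (rsubmx B) => t.
by rewrite e; apply/matrixP => i j; rewrite !mxE.
Qed.

Lemma aff_lsub p q q' (f : R -> 'M[R]_(p, q + q')) : aff f -> aff (fun t => lsubmx (f t)).
Proof.
move=> [A [B e]]; exists (lsubmx A), (lsubmx B) => t.
by rewrite e; apply/matrixP => i j; rewrite !mxE.
Qed.

Lemma aff_usub p p' q (f : R -> 'M[R]_(p + p', q)) : aff f -> aff (fun t => usubmx (f t)).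
Proof.
move=> [A [B e]]; exists (usubmx A), (usubmx B) => t.
by rewrite e; apply/matrixP => i j; rewrite !mxE.
Qed.

Lemma aff_dsub p p' q (f : R -> 'M[R]_(p + p', q)) : aff f -> aff (fun t => dsubmx (f t)).
Proof.
move=> [A [B e]]; exists (dsubmx A), (dsubmx B) => t.
by rewrite e; apply/matrixP => i j; rewrite !mxE.
Qed.

Lemma aff_row_cast n1 n2 q (f : R -> 'M[R]_((n1 + n2) + ((n1 + n2) + (n1 + n2)), q)) :
  aff f -> aff (fun t => row_cast (f t)).
Proof.
move=> [A [B e]]; exists (row_cast A), (row_cast B) => t.
by rewrite e /row_cast; case: _ / (addnA _ _ _); rewrite !castmx_id.
Qed.

Lemma perf_form_perturb nx nl mp kp gamma (S : R -> perf_sys R nx nl mp kp) X P :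
  X^T = X -> P^T = P -> aff (fun t => perf_factor (S t)) ->
  negdef (perf_form gamma (S 0) X P) ->
  exists2 e : R, 0 < e & forall t, `|t| < e -> negdef (perf_form gamma (S t) X P).
Proof.
move=> sX sP [A [B eS]]; rewrite /perf_form eS scale0r addr0; set M := perf_middle _ _ _ _ _.
have sM : M^T = M.
  by rewrite /M /perf_middle /antidiag !(tr_block_mx, trmx0, tr_scalar_mx) sX sP.
move=> HA; pose H1 := A^T *m M *m B + B^T *m M *m A; pose H2 := B^T *m M *m B.
have [] := @negdef_perturb _ _ _ H1 H2 HA.
- by rewrite /H1 linearD /= !trmx_mul !trmxK sM !mulmxA addrC.
- by rewrite /H2 !trmx_mul !trmxK sM !mulmxA.
move=> e e0 He; exists e => // t /He; rewrite eS.
suff -> : A^T *m M *m A + t *: H1 + t ^+ 2 *: H2 = (A + t *: B)^T *m M *m (A + t *: B) by [].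
have -> : (A + t *: B)^T = A^T + t *: B^T by rewrite linearD linearZ.
rewrite !(mulmxDr, mulmxDl) -!scalemxAl -!scalemxAr scalerA -expr2.
by rewrite /H1 /H2 scalerDr !addrA.
Qed.

Lemma aff_perf_factor nx nl mp kp (S : R -> perf_sys R nx nl mp kp) :
  aff (fun t => pA11 (S t)) -> aff (fun t => pA12 (S t)) -> aff (fun t => pB1 (S t)) ->
  aff (fun t => pA21 (S t)) -> aff (fun t => pA22 (S t)) -> aff (fun t => pB2 (S t)) ->
  aff (fun t => pC1 (S t)) -> aff (fun t => pC2 (S t)) -> aff (fun t => pD (S t)) ->
  aff (fun t => perf_factor (S t)).
Proof.
move=> *; rewrite /perf_factor.
by do ![apply: aff_const | apply: aff_col | apply: aff_row].
Qed.

End Affine.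

Ltac affine := do ![assumption | apply: aff_const | apply: affD | apply: affN | apply: affMl
  | apply: affMr | apply: aff_col | apply: aff_row | apply: aff_block | apply: aff_tr
  | apply: aff_rsub | apply: aff_lsub | apply: aff_usub | apply: aff_dsub
  | apply: aff_row_cast | apply: aff_scalar].

Section SynAffine.
Variable R : realType.
Variables (n1 n2 l mp kp m1 m2 k1 k2 : nat).
Notation n := (n1 + n2)%N.
Notation m := (m1 + m2)%N.
Notation k := (k1 + k2)%N.
Variables (G : plant R n l l mp kp m k) (v : lyap_vars R n1 n2).
Variables (X2 Y2 : 'M[R]_l) (c : ctrl_vars R n l m k).

Lemma aff_syn_scale : aff (fun t => perf_factor (syn_sys G v ((1 + t) *: X2) Y2 c)).
Proof.
have a1 : aff (fun t => (1 + t) *: X2).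
  by exists X2, X2 => t; rewrite scalerDl scale1r.
by apply: aff_perf_factor; rewrite /syn_sys /synK21 /projR /syn_block /=; affine.
Qed.

Definition lyap_shift (t : R) : lyap_vars R n1 n2 :=
  LyapVars (vS3 v + t%:M) (vT1 v + t%:M) (vS22 v) (vT22 v) (vW v).

(** The upper right block is [S2^T A11 T2], free of [S3] and [T1]; so this product of two shifted
    matrices does not spoil affine dependence on [t]. *)
Lemma projU_shift t :
  projU ((lyX1 (lyap_shift t))^T *m gA11 G *m lyY1 (lyap_shift t)) =
  projU ((lyX1 v)^T *m gA11 G *m lyY1 v).
Proof.
rewrite /projU; congr block_mx.
by rewrite !ursubmx_mul !usub_X1 /lyY1 !row_mxKr.
Qed.

Lemma aff_syn_shift : aff (fun t => perf_factor (syn_sys G (lyap_shift t) X2 Y2 c)).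
Proof.
have aK : aff (fun t => synK11 G (lyap_shift t) c).
  exists (synK11 G v c), 0 => t.
  by rewrite scaler0 addr0 /synK11 projU_shift.
by apply: aff_perf_factor; rewrite /syn_sys /synK21 /projR /syn_block /=; affine.
Qed.

Lemma lyXX_shift t : lyXX (lyap_shift t) =
  lyXX v + t *: block_mx 1%:M 0 0 (block_mx 0 0 0 1%:M).
Proof.
rewrite /lyXX !scale_block_mx !add_block_mx !scaler0 !addr0 !scale_scalar_mx !mulr1.
by [].
Qed.
End SynAffine.

(** * From synthesis variables to a controller *)

Section Reconstruction.
Variable R : realType.

(** Root counting: the [l + 1] distinct numbers [(1 + t i)^-1] cannot all be eigenvalues of [A]. The
    offset in [i.+2] makes every [t i] strictly smaller than [e]. *)
Lemma scale_unitmx l (A : 'M[R]_l) (e : R) : 0 < e ->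
  exists t, [/\ `|t| < e, 0 < 1 + t & 1%:M - (1 + t) *: A \in unitmx].
Proof.
move=> e0; pose t i : R := e / i.+2%:R; pose mu i := (1 + t i)^-1.
have t0 i : 0 < t i by rewrite divr_gt0.
have t1 i : 0 < 1 + t i by have := t0 i; lra.
have [/allP H|] := boolP (all (root (char_poly A)) [seq mu i | i <- iota 0 l.+1]).
  suff : (size [seq mu i | i <- iota 0 l.+1] < size (char_poly A))%N.
    by rewrite size_char_poly size_map size_iota ltnn.
  apply: max_poly_roots; [exact/monic_neq0/char_poly_monic | exact/allP |].
  rewrite map_inj_uniq ?iota_uniq // => i j /invr_inj /addrI /(mulfI (lt0r_neq0 e0)) /invr_inj /eqP.
  by rewrite eqr_nat => /eqP [].
case/allPn => _ /mapP[i _ ->]; rewrite -eigenvalue_root_char /eigenvalue negbK => /eqP ker0.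
exists (t i); split=> //.
  rewrite gtr0_norm // /t ltr_pdivrMr ?ltr0n // ltr_pMr // ltr1n //.
have -> : 1%:M - (1 + t i) *: A = - (1 + t i) *: (A - (mu i)%:M).
  rewrite scalerBr !scaleNr opprK scale_scalar_mx /mu mulfV ?lt0r_neq0 //.
  by rewrite addrC.
rewrite unitmxZ ?unitfE ?oppr_eq0 ?lt0r_neq0 //.
rewrite -row_free_unit -kermx_eq0; exact/eqP.
Qed.

Lemma classPp_scale r s (V : set 'M[R]_(r, s)) (X : 'M_(r + s)) a :
  V 0 -> 0 < a -> classPp V X -> classPp V (a *: X).
Proof.
move=> V0 a0 /(classPp_lift _ V0)[sX H]; apply/(classPp_lift _ V0); split.
  by rewrite linearZ /= sX.
by move=> D VD x x0; rewrite -scalemxAl dotZr mulr_gt0 ?H.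
Qed.

Variables (n1 n2 : nat).
Notation n := (n1 + n2)%N.

Lemma tr_row3_cast p (a b c : 'M[R]_(p, n)) :
  (row_mx (row_mx a b) c)^T = row_cast (row_mx a (row_mx b c))^T.
Proof. by rewrite !tr_row_mx row_cast_col. Qed.

Lemma block_row3 p p' (T1 T2 T3 : 'M[R]_(p, n)) (Z1 Z2 Z3 : 'M[R]_(p', n)) :
  block_mx (row_mx T1 T2) T3 (row_mx Z1 Z2) Z3 =
  row_mx (row_mx (col_mx T1 Z1) (col_mx T2 Z2)) (col_mx T3 Z3).
Proof. by rewrite block_mxEh -!block_mxEv block_mxEh. Qed.

Variable v : lyap_vars R n1 n2.
Hypothesis sv : lyap_sym v.

Lemma tr_T2S2 : (lyT2 v)^T *m lyS2 v = block_mx (vS22 v) 0 0 (vT22 v).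
Proof.
case: sv => _ _ sS sT; rewrite /lyT2 /lyS2 tr_block_mx mulmx_block !trmx1 trmx0 sT.
by rewrite !(mul1mx, mul0mx, mulmx0, mulmx1, addr0, add0r) linearN /= addrN.
Qed.

Lemma tr_S2T2 : (lyS2 v)^T *m lyT2 v = (lyT2 v)^T *m lyS2 v.
Proof.
rewrite -[LHS]trmxK trmx_mul trmxK tr_T2S2 tr_block_mx !trmx0.
by case: sv => _ _ -> ->.
Qed.

(* The factor [U1] of [T^T X = [1 0; X1^T U1]] forced by the choice [Z1 = 1]; its
   upper right block vanishes because [T2^T S2] is symmetric. *)
Definition recU : 'M[R]_(n + n, n + n) :=
  block_mx ((lyT2 v)^T - (lyS2 v)^T *m vT1 v) 0 (1%:M - vS3 v *m vT1 v)
    (lyS2 v - vS3 v *m lyT2 v).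
(** This is [T] for [Z1 = 1], with columns bracketed as [n + (n + n)]. [W] is its inverse, so [recX]
    is the solution of [Y'^T X Y' = lyXX v]. *)
Let Y' : 'M[R]_(n + (n + n)) :=
  block_mx (vT1 v) (row_mx (lyT2 v) 1%:M) (col_mx 1%:M 0) (block_mx 0 0 1%:M 0).
Let W : 'M[R]_(n + (n + n)) :=
  block_mx 0 (row_mx 1%:M 0) (col_mx 0 1%:M) (block_mx 0 1%:M (- vT1 v) (- lyT2 v)).
Definition recX : 'M[R]_(n + (n + n)) := W^T *m lyXX v *m W.

Definition mxS := (mul1mx, mul0mx, mulmx0, mulmx1, addr0, add0r, add_row_mx, add_col_mx,
  mul_row_col, mul_mx_row, mul_col_mx, mul_row_block, mul_block_col, mulmx_block, add_block_mx).

Lemma recYW : Y' *m W = 1%:M.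
Proof.
rewrite /Y' /W !mxS -?block_mxEv ?mulmxN ?addrN.
have -> : row_mx (col_mx 1%:M 0) 0 = block_mx 1%:M 0 0 0 :> 'M[R]_(n + n).
  by rewrite block_mxEh col_mx0.
have -> : col_mx 0 (row_mx 0 1%:M) = block_mx 0 0 0 1%:M :> 'M[R]_(n + n).
  by rewrite block_mxEv row_mx0.
by rewrite add_block_mx !addr0 !add0r row_mx0 col_mx0 -!scalar_mx_block.
Qed.

Lemma rec_posdef : posdef (lyXX v) -> posdef recX.
Proof.
move=> HX; apply: posdef_congr HX _ => x Wx.
by rewrite -[x]mul1mx -recYW -mulmxA Wx mulmx0.
Qed.

Lemma recYX : Y'^T *m recX = block_mx 1%:M 0 (lyX1 v)^T recU.
Proof.
have YW : Y'^T *m W^T = 1%:M by rewrite -trmx_mul (mulmx1C recYW) trmx1.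
case: (sv) => s3 s1 _ _.
rewrite /recX !mulmxA YW mul1mx /lyXX /W /lyX1 /recU !mxS.
rewrite !mulmxN !addrN row_mx0 -!block_mxEv.
have -> : row_mx (col_mx (lyT2 v)^T 1%:M) 0 = block_mx (lyT2 v)^T 0 1%:M 0 :> 'M[R]_(n + n).
  by rewrite block_mxEh col_mx0.
by rewrite add_block_mx !add0r -tr_S2T2 addrN tr_row_mx s3.
Qed.

Let Yc : 'M[R]_((n + (n + n)), (n + n) + n) := block_mx (lyY1 v) 1%:M 1%:M 0.

Lemma recX_cast : Yc^T *m recX = row_cast (block_mx 1%:M 0 (lyX1 v)^T recU).
Proof.
rewrite -recYX -row_cast_mul; congr (_ *m _).
rewrite /Yc /lyY1 [X in block_mx _ _ X _]scalar_mx_block [X in block_mx _ _ X _]block_mxEh.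
rewrite block_row3 tr_row3_cast /Y' block_mxEh [block_mx 0 0 1%:M 0]block_mxEh.
by rewrite -[col_mx (row_mx _ _) _]block_mxEv [block_mx (lyT2 v) _ _ _]block_mxEh col_mx0.
Qed.

Lemma recU_unit : posdef (lyXX v) -> recU \in unitmx.
Proof.
move=> /rec_posdef/posdef_unit uX.
have : Y'^T *m recX \in unitmx.
  by rewrite unitmx_mul uX unitmx_tr andbT; case/mulmx1_unit: recYW.
by rewrite recYX !unitmxE det_lblock det1 mul1r.
Qed.

End Reconstruction.

Section TransformationInverse.
Variables (R : realType) (p q m k p' q' : nat).
Variables (A : 'M[R]_(p, q)) (B : 'M[R]_(p, m)) (C : 'M[R]_(k, q)).
Variables (X : 'M[R]_(p, p')) (Y : 'M[R]_(q, q')) (U : 'M[R]_p').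
Variables (K : 'M[R]_(p', q')) (L : 'M[R]_(p', k)) (M : 'M[R]_(m, q')) (N : 'M[R]_(m, k)).
Hypothesis uU : U \in unitmx.

(** For [Z = 1] and [U] invertible the transformation is triangular: [N] is shared, [L] and [M] then
    give the input and output matrices, and [K] the remaining one. *)
Lemma trL_inv : L = trL B X U (invmx U *m (L - X^T *m B *m N)) N.
Proof. by rewrite /trL mulKVmx // subrK. Qed.

Lemma trM_inv : M = trM C Y 1%:M (M - N *m C *m Y) N.
Proof. by rewrite /trM mulmx1 subrK. Qed.

Lemma trK_inv : K = trK A B C X Y U 1%:M
  (invmx U *m (K - (X^T *m A *m Y + (X^T *m B *m M + L *m C *m Y - X^T *m B *m N *m C *m Y))))
  (invmx U *m (L - X^T *m B *m N)) (M - N *m C *m Y) N.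
Proof.
rewrite /trK !mulmx1 !mulKVmx // mulmxBr !mulmxBl !mulmxA.
move: (X^T *m A *m Y) (X^T *m B *m M) (L *m C *m Y) (X^T *m B *m N *m C *m Y) => a b d e.
by apply/matrixP => i j; rewrite !mxE; ring.
Qed.

End TransformationInverse.

(** * The reconstructed controller and multiplier *)

Section Controller.
Variable R : realType.
Variables (n1 n2 r s mp kp m1 m2 k1 k2 : nat).
Notation n := (n1 + n2)%N.
Notation m := (m1 + m2)%N.
Notation k := (k1 + k2)%N.
Notation l := (r + s)%N.
Variables (V : set 'M[R]_(r, s)) (G : plant R n l l mp kp m k) (gamma : R).
Variables (v : lyap_vars R n1 n2) (X2 Y2 : 'M[R]_l) (c : ctrl_vars R n l m k).

Hypotheses (lB1 : lower_btri (gB1 G)) (lC1 : lower_btri (gC1 G)) (zB2 : last_cols0 (gB2 G)).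
Hypotheses (V0 : V 0) (sv : lyap_sym v).
Hypotheses (pX2 : classPp V X2) (pY2 : classPd V Y2) (hc : ctrl_structured c).
Hypotheses (hlmi : negdef (perf_form gamma (syn_sys G v X2 Y2 c) 1%:M 1%:M)).
Hypothesis pXX : posdef (lyXX v).
Let U1 := recU v.
Let U2 := 1%:M - X2 *m Y2.
Hypothesis uU2 : U2 \in unitmx.
Let uU1 : U1 \in unitmx := recU_unit sv pXX.
Let sX2 : X2^T = X2 := ((classPp_lift _ V0).1 pX2).1.
Let sY2 : Y2^T = Y2 := ((classPd_lift _ V0).1 pY2).1.
Notation X1 := (lyX1 v).
Notation Y1 := (lyY1 v).

(** The lower right block is forced by the zero in [T2^T P = [1 0; X2^T U2]], whose first row also
    makes [Y2] the upper left block of the inverse. *)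
Definition recP : 'M[R]_(l + l) :=
  block_mx X2 U2 U2^T (Y2 *m X2 *m Y2 - Y2).
Let T2 : 'M[R]_(l + l) := block_mx Y2 1%:M 1%:M 0.

Lemma recP_sym : recP^T = recP.
Proof.
rewrite /recP tr_block_mx trmxK sX2; congr block_mx.
by rewrite linearB /= !trmx_mul sX2 sY2 mulmxA.
Qed.

Lemma recP_cast : T2^T *m recP = block_mx 1%:M 0 X2^T U2.
Proof.
rewrite /T2 /recP tr_block_mx sX2 sY2 !trmx1 trmx0 mulmx_block !mul1mx !mul0mx !addr0.
have -> : U2^T = 1%:M - Y2 *m X2 by rewrite linearB /= trmx1 trmx_mul sX2 sY2.
by rewrite /U2 mulmxBr mulmx1 mulmxA [_ + (1%:M - _)]addrC subrK -[_ - Y2]opprB addrN.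
Qed.

Let Bc1 := invmx U1 *m (synL1 G c - X1^T *m gB1 G *m vN c).
Let Bc2 := invmx U2 *m (vL2 c - X2^T *m gB2 G *m vN c).
Let Cc1 := synM1 G c - vN c *m gC1 G *m Y1.
Let Cc2 := vM2 c - vN c *m gC2 G *m Y2.

(* Solves [U2 Dc + X2 Delta Y2 + Delta^T = 0], the off-diagonal block of the
   transformed multiplier condition. *)
Definition recDelta (D : 'M[R]_(r, s)) : 'M[R]_l :=
  - (invmx U2 *m ((lift_Delta D)^T + X2 *m lift_Delta D *m Y2)).

Definition recK : controller R r s (n + n) l l m k := {|
  cA11 := invmx U1 *m (synK11 G v c - (X1^T *m gA11 G *m Y1 + (X1^T *m gB1 G *m synM1 G c
            + synL1 G c *m gC1 G *m Y1 - X1^T *m gB1 G *m vN c *m gC1 G *m Y1)));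
  cA12 := invmx U1 *m (vK12 c - (X1^T *m gA12 G *m Y2 + (X1^T *m gB1 G *m vM2 c
            + synL1 G c *m gC2 G *m Y2 - X1^T *m gB1 G *m vN c *m gC2 G *m Y2)));
  cB1 := Bc1;
  cA21 := invmx U2 *m (synK21 G v X2 c - (X2^T *m gA21 G *m Y1 + (X2^T *m gB2 G *m synM1 G c
            + vL2 c *m gC1 G *m Y1 - X2^T *m gB2 G *m vN c *m gC1 G *m Y1)));
  cA22 := invmx U2 *m (vK22 c - (X2^T *m gA22 G *m Y2 + (X2^T *m gB2 G *m vM2 c
            + vL2 c *m gC2 G *m Y2 - X2^T *m gB2 G *m vN c *m gC2 G *m Y2)));
  cB2 := Bc2;
  cC1 := Cc1; cC2 := Cc2; cD := vN c;
  cDelta := recDelta |}.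

Lemma rec_same : same_ctrl G recK v X2 Y2 c U1 1%:M U2 1%:M.
Proof.
split.
- exact: trK_inv.
- exact: trK_inv.
- exact: trK_inv.
- exact: trK_inv.
- exact: trL_inv.
- exact: trL_inv.
- exact: trM_inv.
- exact: trM_inv.
- by [].
Qed.

(** The prescribed parts of [synK11], [synL1], [synM1] and [synK21] are exactly the offending blocks
    of what the inverse transformation subtracts. The structured remainders keep their zeros under
    [invmx U1], itself lower triangular, and [invmx U2], which acts on rows only. *)
Lemma rec_class : classK2 recK.
Proof.
case: hc => -[lK lL lM lN] cK cL.
have lU : lower_btri (invmx U1) by apply: lower_btri_inv => //; apply: lower_btri_block.
split; first split => //=.
- apply: lower_btri_mul => //.
  rewrite /lower_btri opprD addrA ursubmxD ursubmxN ur_synK11 //.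
  rewrite /synK11 /projU !(ursubmxD, ursubmxN) lK !block_mxKur.
  set a := ursubmx _; set b := ursubmx _; set d := ursubmx _; set e := ursubmx _.
  by move: a b d e => a b d e; apply/matrixP => i j; rewrite !mxE; ring.
- apply: lower_btri_mul => //.
  rewrite /lower_btri ursubmxD ursubmxN ur_X1B1_lower // /synL1 /projU ursubmxD lL.
  by rewrite block_mxKur add0r subrr.
- rewrite /lower_btri /Cc1 ursubmxD ursubmxN ur_C1Y1_lower // /synM1 /projU ursubmxD lM.
  by rewrite block_mxKur add0r subrr.
- rewrite /last_cols0 /= -mulmx_rsub opprD addrA rsubmxD rsubmxN (rs_synK21 _ lC1) //.
  rewrite /synK21 /projR !(rsubmxD, rsubmxN) cK !row_mxKr add0r.
  by rewrite [X in X - _ - _]addrC addrK subrr mulmx0.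
- by rewrite /last_cols0 /= /Bc2 -mulmx_rsub rsubmxD rsubmxN cL rs_B2 // lN mulmx0 subrr mulmx0.
Qed.

(** In the coordinates [z = T2 (y1, y2)] the cross terms are
    [y2^T (U2 Dc + X2 Delta Y2 + Delta^T) y1], which [recDelta] annihilates; the dual and primal
    scaling forms remain. *)
Lemma rec_classP : classP V (cDelta recK) recP.
Proof.
split; first exact: recP_sym.
move=> D VD; apply/scaling_posdefE; first exact: recP_sym.
move=> z z0; have [y1 [y2 ez]] : exists y1 y2, z = T2 *m col_mx y1 y2.
  exists (dsubmx z), (usubmx z - Y2 *m dsubmx z).
  by rewrite /T2 mul_block_col !mul1mx mul0mx addr0 [_ + (_ - _)]addrC subrK vsubmxK.
have y0 : y1 != 0 \/ y2 != 0.
  have [y10|] := eqVneq y1 0; [right|by left].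
  by apply: contra_neq z0 => y20; rewrite ez y10 y20 col_mx0 mulmx0.
have -> : dot z (recP *m (Delta_lc recDelta D *m z)) =
    dot y1 (lift_Delta D *m (Y2 *m y1)) + dot y2 (X2 *m (lift_Delta D *m y2)).
  rewrite {1}ez dot_mull mulmxA recP_cast.
  have -> : z = col_mx (Y2 *m y1 + y2) y1.
    by rewrite ez /T2 mul_block_col !mul1mx mul0mx addr0.
  rewrite /Delta_lc !mul_block_col !mul0mx add0r !addr0 mul1mx dot_col sX2.
  rewrite /recDelta mulNmx mulmxN -(mulmxA (invmx U2)) mulKVmx //.
  rewrite !mulmxDr mulmxDl !mulmxA !dotS -(dot_mull y2) dotC.
  by rewrite (dotC (lift_Delta D *m y2)); ring.
have Hx : y2 != 0 -> 0 < dot y2 (X2 *m (lift_Delta D *m y2)).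
  by apply: ((classPp_lift _ V0).1 pX2).2.
have Hy : y1 != 0 -> 0 < dot y1 (lift_Delta D *m (Y2 *m y1)).
  by apply: ((classPd_lift _ V0).1 pY2).2.
have [y10|/[dup] y10 /Hy hy] := eqVneq y1 0; have [y20|/[dup] y20 /Hx hx] := eqVneq y2 0.
- by case: y0; rewrite ?y10 ?y20 eqxx.
- by rewrite y10 dot0l add0r.
- by rewrite y20 dot0l addr0.
- exact: addr_gt0.
Qed.

Lemma rec_affine : affine_on V recDelta.
Proof.
pose f (D : 'M[R]_(r, s)) : 'M[R]_l :=
  - (invmx U2 *m ((block_mx 0 (2 *: D) 0 0)^T + X2 *m block_mx 0 (2 *: D) 0 0 *m Y2)).
have lf : linear f.
  move=> a D D'; rewrite /f.
  have -> : block_mx 0 (2 *: (a *: D + D')) 0 0 =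
      a *: block_mx 0 (2 *: D) 0 0 + block_mx 0 (2 *: D') 0 0 :> 'M[R]_l.
    by rewrite scale_block_mx add_block_mx !scaler0 !addr0 scalerDr !scalerA mulrC.
  move: (block_mx _ _ _ _) (block_mx _ _ _ _) => B B'.
  rewrite scalerN -opprD scalemxAr -mulmxDr; congr (- (_ *m _)).
  by rewrite linearD linearZ /= mulmxDr mulmxDl -scalemxAr -scalemxAl scalerDr addrACA.
pose fL : {linear 'M[R]_(r, s) -> 'M[R]_l} := HB.pack f (GRing.isLinear.Build _ _ _ _ f lf).
exists (recDelta 0), fL => D _; rewrite /= /recDelta /f -opprD -mulmxDr; congr (- (_ *m _)).
have -> : lift_Delta D = lift_Delta 0 + block_mx 0 (2 *: D) 0 0.
  by rewrite /lift_Delta add_block_mx scaler0 !addr0 add0r.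
by rewrite linearD /= mulmxDr mulmxDl addrACA.
Qed.

Lemma rec_lmi : negdef (perf_form gamma (closed_loop G recK) (recX v) recP).
Proof.
have sX := posdef_sym (rec_posdef pXX).
split; first by apply: perf_form_tr => //; apply: recP_sym.
move=> z z0; rewrite qformE -[z]vsubmxK -[usubmx z]vsubmxK.
(* [V1] and [V2] are right inverses of [T1] and [T2] for [Z1 = 1], [Z2 = 1], so every closed-loop
   vector is an image and definiteness transfers. *)
pose V1 : 'M[R]_((n + n) + n, n + (n + n)) := block_mx 0 1%:M 1%:M (- Y1).
pose V2 : 'M[R]_(l + l) := block_mx 0 1%:M 1%:M (- Y2).
have TV1 : block_mx Y1 1%:M 1%:M 0 *m V1 = 1%:M.
  by rewrite mulmx_block !mxS addrN -scalar_mx_block.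
have TV2 : T2 *m V2 = 1%:M by rewrite mulmx_block !mxS addrN -scalar_mx_block.
have -> : usubmx (usubmx z) = block_mx Y1 1%:M 1%:M 0 *m (V1 *m usubmx (usubmx z)).
  by rewrite mulmxA TV1 mul1mx.
have -> : dsubmx (usubmx z) = T2 *m (V2 *m dsubmx (usubmx z)) by rewrite mulmxA TV2 mul1mx.
rewrite -(syn_sys_form _ sX recP_sym (recX_cast sv) recP_cast rec_same) -qformE.
apply: (proj2 hlmi); apply: contra_neq z0.
rewrite -(col_mx0 _ (n + n + n + (l + l)) mp 1) => /eq_col_mx[].
rewrite -(col_mx0 _ (n + n + n) (l + l) 1) => /eq_col_mx[z1 z2 z3].
rewrite -[z]vsubmxK -[usubmx z]vsubmxK z3 -[usubmx (usubmx z)]mul1mx -TV1 -mulmxA z1.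
by rewrite -[dsubmx (usubmx z)]mul1mx -TV2 -mulmxA z2 !mulmx0 !col_mx0.
Qed.

End Controller.

(** * From a controller to synthesis variables *)

Section Inclusion.
Variable R : realType.
Definition incl a b : 'M[R]_(a + b, a) := col_mx 1%:M 0.

Lemma incl_tr a b q (M : 'M[R]_(a + b, q)) : (incl a b)^T *m M = usubmx M.
Proof.
by rewrite /incl tr_col_mx trmx1 trmx0 -{1}[M]vsubmxK mul_row_col mul1mx mul0mx addr0.
Qed.

Lemma incl_mul a b q (M : 'M[R]_(a, q)) : incl a b *m M = col_mx M 0.
Proof. by rewrite /incl mul_col_mx mul1mx mul0mx. Qed.

Lemma mul_incl a b q (M : 'M[R]_(q, a + b)) : M *m incl a b = lsubmx M.
Proof. by rewrite /incl -{1}[M]hsubmxK mul_row_col mulmx1 mulmx0 addr0. Qed.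

Lemma incl_inj a b (x : 'cV[R]_a) : incl a b *m x = 0 -> x = 0.
Proof.
by rewrite /incl mul_col_mx mul1mx mul0mx -(col_mx0 _ a b 1) => /eq_col_mx[].
Qed.

Lemma posdef_ulsub a b (P : 'M[R]_(a + b)) : posdef P -> posdef (ulsubmx P).
Proof.
move=> HP; have -> : ulsubmx P = (incl a b)^T *m P *m incl a b.
  by rewrite incl_tr mul_incl.
by apply: posdef_congr HP _ => x; apply: incl_inj.
Qed.
End Inclusion.

(** * Triangular factorisation of a Lyapunov certificate *)

Section Factor.
Variable R : realType.
Variables (n1 n2 c1 c2 : nat).
Notation n := (n1 + n2)%N.
Notation nc := (c1 + c2)%N.
Variable X : 'M[R]_(n + nc).
Hypothesis pX : posdef X.
Let sX : X^T = X := posdef_sym pX.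

Let J1 : 'M[R]_(n + nc, n1 + c1) := block_mx (col_mx 1%:M 0) 0 0 (col_mx 1%:M 0).
Let J2 : 'M[R]_(n + nc, n2 + c2) := block_mx (col_mx 0 1%:M) 0 0 (col_mx 0 1%:M).

Let J1E q (M : 'M[R]_(n1 + c1, q)) :
  J1 *m M = col_mx (col_mx (usubmx M) 0) (col_mx (dsubmx M) 0).
Proof. by rewrite /J1 -{1}[M]vsubmxK !mxS. Qed.

Let J2E q (M : 'M[R]_(n2 + c2, q)) :
  J2 *m M = col_mx (col_mx 0 (usubmx M)) (col_mx 0 (dsubmx M)).
Proof. by rewrite /J2 -{1}[M]vsubmxK !mxS. Qed.

Let J2_inj (x : 'cV_(n2 + c2)) : J2 *m x = 0 -> x = 0.
Proof.
rewrite J2E -(col_mx0 _ n nc 1) => /eq_col_mx[].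
rewrite -(col_mx0 _ n1 n2 1) -(col_mx0 _ c1 c2 1) => /eq_col_mx[_ a] /eq_col_mx[_ b].
by rewrite -[x]vsubmxK a b col_mx0.
Qed.

Let Jsum q (M : 'M[R]_(n + nc, q)) : M = J1 *m (J1^T *m M) + J2 *m (J2^T *m M).
Proof.
rewrite J1E J2E /J1 /J2 !tr_block_mx !tr_col_mx !trmx1 !trmx0.
rewrite -[M]vsubmxK -[usubmx M]vsubmxK -[dsubmx M]vsubmxK.
by rewrite !mxS !col_mxKu !col_mxKd.
Qed.

Let R22 := J2^T *m X *m J2.
Let Q := invmx R22.
Let R21 := J2^T *m X *m J1.
Let e1 := incl R n1 c1.
Let e2 := incl R n2 c2.
Let pR22 : posdef R22 := posdef_congr pX J2_inj.
Let sQ : Q^T = Q := posdef_sym (posdef_inv pR22).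
Let sch := J1^T *m X *m J1 - R21^T *m Q *m R21.

(* [J1] and [J2] embed the states of index 1 and 2 of plant and controller. The first
   [n1] columns of [facG] are [X]-orthogonal to the range of [J2], the last [n2] lie
   in that range; this makes the blocks of [facG] and [X *m facG] triangular. *)
Definition facv : lyap_vars R n1 n2 :=
  LyapVars (ulsubmx X) (ulsubmx (invmx X)) (e1^T *m sch *m e1) (e2^T *m Q *m e2)
    (e2^T *m Q *m R21 *m e1).

Let G1 := J1 *m e1 - J2 *m (Q *m R21 *m e1).
Let G2 := J2 *m (Q *m e2).
Definition facG : 'M[R]_(n + nc, n) := row_mx G1 G2.

Lemma facv_sym : lyap_sym facv.
Proof.
split=> /=.
- by rewrite -[in RHS]sX trmx_ulsub.
- by rewrite trmx_ulsub trmx_inv sX.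
- by rewrite !trmx_mul trmxK /sch linearB /= !trmx_mul !trmxK sX sQ !mulmxA.
- by rewrite !trmx_mul trmxK sQ mulmxA.
Qed.

Lemma facG_u : usubmx facG = lyT2 facv.
Proof.
rewrite /facG /G1 /G2 J1E !J2E !(opp_col_mx, add_col_mx).
rewrite -block_mxEh block_mxEv col_mxKu -block_mxEh [usubmx e1]col_mxKu subr0 sub0r.
by rewrite /lyT2 /= -(mulmxA _ Q e2) -(mulmxA _ Q R21) -(mulmxA _ (Q *m R21)) !incl_tr.
Qed.

(** Coordinates of index 1 are reached only through [J1 *m e1], and [e1] selects plant states. This
    zero makes [facZ] lower triangular. *)
Lemma facG_d : usubmx (dsubmx facG) = 0.
Proof.
rewrite /facG /G1 /G2 J1E !J2E !(opp_col_mx, add_col_mx).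
rewrite -block_mxEh block_mxEv col_mxKd -block_mxEh block_mxEv col_mxKu [dsubmx e1]col_mxKd.
by rewrite subr0 row_mx0.
Qed.

Let R22Q : J2^T *m X *m J2 *m Q = 1%:M.
Proof. by rewrite mulmxV // posdef_unit. Qed.

Let trR21 : R21^T = J1^T *m X *m J2.
Proof. by rewrite /R21 !trmx_mul trmxK sX mulmxA. Qed.

(** Subtracting [J2 Q R21 e1] removes the [J2] component; what is left in the [J1] component is the
    Schur complement [sch]. *)
Let XG1 : X *m G1 = J1 *m (sch *m e1).
Proof.
rewrite [LHS]Jsum.
have -> : J2^T *m (X *m G1) = 0.
  by rewrite /G1 !mulmxBr !mulmxA R22Q mul1mx /R21 subrr.
rewrite mulmx0 addr0; congr (_ *m _).
by rewrite /G1 /sch trR21 !mulmxBr mulmxBl !mulmxA.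
Qed.

Let XG2 : X *m G2 = J1 *m (R21^T *m Q *m e2) + J2 *m e2.
Proof.
rewrite [LHS]Jsum; congr (_ + _); congr (_ *m _).
  by rewrite /G2 trR21 !mulmxA.
by rewrite /G2 !mulmxA R22Q mul1mx.
Qed.

Lemma facXG_u : usubmx (X *m facG) = lyS2 facv.
Proof.
rewrite /facG mul_mx_row XG1 XG2 !J1E J2E !add_col_mx -block_mxEh block_mxEv col_mxKu.
rewrite -block_mxEh !addr0 !add0r /e2 /incl col_mxKu /lyS2 /=.
rewrite -(mulmxA _ sch) -/(incl R n1 c1) -/(incl R n2 c2) incl_tr; congr block_mx.
by rewrite -incl_tr [RHS]trmx_mul [in RHS]trmx_mul (trmx_mul _ Q) trmxK sQ !mulmxA.
Qed.

(** Dually, the index 2 part of [X *m facG] comes only from [J2 *m e2], and [e2] selects plant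
    states. This zero makes [facU] lower triangular. *)
Lemma facXG_d : dsubmx (dsubmx (X *m facG)) = 0.
Proof.
rewrite /facG mul_mx_row XG1 XG2 !J1E J2E !add_col_mx -block_mxEh block_mxEv col_mxKd.
by rewrite -block_mxEh block_mxEv col_mxKd !add0r /e2 /incl col_mxKd row_mx0.
Qed.

Definition facZ : 'M[R]_(nc, n + n) := row_mx (dlsubmx (invmx X)) (dsubmx facG).
Definition facU : 'M[R]_(n + n, nc) := col_mx (dsubmx (X *m facG))^T (ursubmx X).

Lemma facZ_lower : lower_btri facZ.
Proof. by rewrite /lower_btri -usub_rsub row_mxKr facG_d. Qed.

Lemma facU_lower : lower_btri facU.
Proof. by rewrite /lower_btri /ursubmx col_mxKu -trmx_dsub facXG_d trmx0. Qed.

Lemma facT1_unit : vT1 facv \in unitmx.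
Proof. exact/posdef_unit/posdef_ulsub/posdef_inv. Qed.

Lemma facT2_unit : lyT2 facv \in unitmx.
Proof.
rewrite unitmxE /lyT2 det_lblock det1 mul1r -unitmxE.
by apply/posdef_unit/posdef_congr => [|x]; [apply: posdef_inv | apply: incl_inj].
Qed.

Let Y' : 'M[R]_(n + nc, n + (n + n)) :=
  row_mx (lsubmx (invmx X)) (row_mx facG (col_mx 1%:M 0)).

Lemma facYX : Y'^T *m X = block_mx 1%:M 0 (lyX1 facv)^T facU.
Proof.
rewrite /Y' tr_row_mx (tr_row_mx facG) !mul_col_mx -/(incl R n nc) incl_tr.
rewrite -mul_incl trmx_mul -mulmxA trmx_inv sX mulVmx ?posdef_unit // mulmx1.
rewrite /incl tr_col_mx trmx1 trmx0.
rewrite block_mxEv; congr col_mx.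
have [sS3 _ _ _] := facv_sym; rewrite /lyX1 tr_row_mx -facXG_u sS3 /facU.
rewrite -block_mxEh block_mxEv; congr col_mx.
  by rewrite -tr_col_mx vsubmxK trmx_mul sX.
by rewrite hsubmxK.
Qed.

Let YE : Y' = block_mx (vT1 facv) (row_mx (lyT2 facv) 1%:M)
  (dlsubmx (invmx X)) (row_mx (dsubmx facG) 0).
Proof.
rewrite block_mxEh /Y' -block_mxEv block_mxEh -facG_u vsubmxK; congr row_mx.
by rewrite -[LHS]vsubmxK; congr col_mx; apply/matrixP => i j; rewrite !mxE.
Qed.

(** The first block column follows from the first row by symmetry. In the middle block the parts of
    [facU] and [facZ] have complementary zeros, so their product vanishes and [S2^T T2] remains.
    Since [Y'] may lack full column rank, this yields only semidefiniteness of [lyXX facv]. *)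
Lemma lyXX_fac : lyXX facv = Y'^T *m X *m Y'.
Proof.
have YXY : Y'^T *m X *m Y' = block_mx (vT1 facv) (row_mx (lyT2 facv) 1%:M)
    ((lyX1 facv)^T *m vT1 facv + facU *m dlsubmx (invmx X))
    ((lyX1 facv)^T *m row_mx (lyT2 facv) 1%:M + facU *m row_mx (dsubmx facG) 0).
  by rewrite facYX {1}YE mulmx_block !mul1mx !mul0mx !addr0.
have : (Y'^T *m X *m Y')^T = Y'^T *m X *m Y' by rewrite !trmx_mul trmxK sX mulmxA.
rewrite YXY tr_block_mx => /eq_block_mx[_ _ <- _].
rewrite /lyXX tr_row_mx trmx1; congr block_mx.
have [sS3 _ _ _] := facv_sym.
rewrite /lyX1 tr_row_mx sS3 /facU (mul_mx_row _ (lyT2 facv)).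
rewrite (mul_mx_row _ (dsubmx facG)) !mul_col_mx !mulmx1 !mulmx0.
rewrite add_row_mx !add_col_mx !addr0 block_mxEh; congr (row_mx (col_mx _ _) _).
  rewrite -(tr_S2T2 facv_sym) -[(dsubmx (X *m facG))^T]hsubmxK -trmx_dsub facXG_d trmx0.
  by rewrite -[X in row_mx _ 0 *m X]vsubmxK facG_d mul_row_col mulmx0 mul0mx !addr0.
rewrite -[LHS]facXG_u -mul_usub_mx -{1}[usubmx X]hsubmxK -{1}[facG]vsubmxK.
by rewrite (mul_row_col _ _ (usubmx facG)) facG_u.
Qed.

Lemma fac_cast :
  (block_mx (lyY1 facv) 1%:M facZ 0)^T *m X = row_cast (block_mx 1%:M 0 (lyX1 facv)^T facU).
Proof.
rewrite -facYX -row_cast_mul; congr (_ *m _).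
rewrite /lyY1 /facZ block_row3 tr_row3_cast; congr (row_cast _^T).
rewrite -facG_u vsubmxK /Y' -[in RHS](vsubmxK (lsubmx _)).
by congr (row_mx (col_mx _ _) _); apply/matrixP => i j; rewrite !mxE.
Qed.

Lemma facXX_form (x y w : 'cV_n) :
  let z := block_mx (lyY1 facv) 1%:M facZ 0 *m col_mx (col_mx x y) w in
  let t := col_mx x (col_mx y w) in
  dot t (lyXX facv *m t) = dot z (X *m z).
Proof.
move=> z t; rewrite lyXX_fac -!mulmxA dot_mulr trmxK.
suff -> : Y' *m t = z by [].
rewrite YE /z /t /lyY1 /facZ !(mul_block_col, mul_row_col) !mul1mx !mul0mx !addr0.
by rewrite !addrA.
Qed.

End Factor.

(** * Primal and dual scalings extracted from a closed-loop multiplier *)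

Section Multiplier.
Variable R : realType.
Variables (r s lc : nat).
Notation l := (r + s)%N.
Variables (V : set 'M[R]_(r, s)) (Dc : 'M[R]_(r, s) -> 'M[R]_lc) (P : 'M[R]_(l + lc)).
Hypotheses (V0 : V 0) (HP : classP V Dc P).
Let sP : P^T = P := HP.1.

Let P_gt0 D z : V D -> z != 0 -> 0 < dot z (P *m (Delta_lc Dc D *m z)).
Proof. by move=> VD; apply: (scaling_posdefE _ sP).1; apply: HP.2. Qed.

(** [P] need not be definite; a kernel vector would make the form at the point 0 of [V] vanish. *)
Let uP : P \in unitmx.
Proof.
apply: inj_unitmx => z Pz; apply/eqP; apply: contraT => /(P_gt0 V0).
by rewrite dot_mulr sP Pz dot0l ltxx.
Qed.

Lemma mult_primal : classPp V (ulsubmx P).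
Proof.
apply/(classPp_lift _ V0); split; first by rewrite -[in RHS]sP trmx_ulsub.
move=> D VD x x0; have /(P_gt0 VD) : incl R l lc *m x != 0.
  by apply: contra_neq x0; apply: incl_inj.
rewrite dot_mull incl_tr incl_mul /Delta_lc mul_block_col mulmx0 mul0mx !addr0 mulmx0.
by rewrite -mul_usub_mx -{1}[usubmx P]hsubmxK mul_row_col !addr0 mulmx0 addr0.
Qed.

(** Testing the multiplier condition at [P^-1 (x, 0)] cancels [P] on the left and leaves
    [x^T Delta_l Y2 x]; the primal case tests at [(x, 0)]. *)
Lemma mult_dual : classPd V (ulsubmx (invmx P)).
Proof.
apply/(classPd_lift _ V0); split; first by rewrite trmx_ulsub trmx_inv sP.
move=> D VD x x0; have /(P_gt0 VD) : invmx P *m (incl R l lc *m x) != 0.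
  by apply: contra_neq x0 => /(congr1 (mulmx P)); rewrite mulKVmx // mulmx0; apply: incl_inj.
rewrite dot_mull trmx_inv sP mulKmx // dot_mull incl_tr (mulmxA (invmx P)) mul_incl.
rewrite -[lsubmx _]vsubmxK (mul_col_mx (usubmx (lsubmx _))) /Delta_lc.
rewrite mul_block_col mul0mx addr0 col_mxKu.
have -> : usubmx (lsubmx (invmx P)) = ulsubmx (invmx P) by apply/matrixP => i j; rewrite !mxE.
by [].
Qed.

Lemma mult_dual_unit : ulsubmx (invmx P) \in unitmx.
Proof.
have [_ H] := (classPd_lift _ V0).1 mult_dual.
apply: inj_unitmx => x Yx; apply/eqP; apply: contraT => /(H _ V0).
by rewrite Yx mulmx0 dot0r ltxx.
Qed.

Lemma mult_cast :
  (block_mx (ulsubmx (invmx P)) 1%:M (dlsubmx (invmx P)) 0)^T *m P =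
  block_mx 1%:M 0 (ulsubmx P)^T (ursubmx P).
Proof.
have -> : block_mx (ulsubmx (invmx P)) 1%:M (dlsubmx (invmx P)) 0 =
    row_mx (invmx P *m incl R l lc) (incl R l lc).
  rewrite mul_incl block_mxEh; congr row_mx.
  by rewrite -[RHS]vsubmxK; congr col_mx; apply/matrixP => i j; rewrite !mxE.
rewrite tr_row_mx mul_col_mx trmx_mul trmx_inv sP -mulmxA mulVmx // mulmx1 incl_tr.
rewrite trmx_ulsub sP block_mxEv -[usubmx P]hsubmxK; congr (col_mx _ _).
by rewrite /incl tr_col_mx trmx1 trmx0.
Qed.

End Multiplier.

Section ControllerPerturbation.
Variable R : realType.
Variables (n1 n2 l mp kp m1 m2 k1 k2 : nat).
Notation n := (n1 + n2)%N.
Notation m := (m1 + m2)%N.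
Notation k := (k1 + k2)%N.
Variables (G : plant R n l l mp kp m k) (v : lyap_vars R n1 n2) (gamma : R).
Variables (X2 Y2 : 'M[R]_l) (c : ctrl_vars R n l m k).
Variables (F1 : 'M[R]_(n + n)) (F2 : 'M[R]_l).

Definition ctrl_add : ctrl_vars R n l m k := {|
  vK11 := vK11 c + F1; vK12 := vK12 c; vL1 := vL1 c;
  vK21 := vK21 c; vK22 := vK22 c + F2; vL2 := vL2 c;
  vM1 := vM1 c; vM2 := vM2 c; vN := vN c |}.

Lemma row_castD q (A B : 'M[R]_(n + (n + n), q)) :
  row_cast (A + B) = row_cast A + row_cast B.
Proof. by rewrite /row_cast; case: _ / (addnA _ _ _); rewrite !castmx_id. Qed.

(** Rows of the first channel are grouped as [n + (n + n)] but columns as [(n + n) + n]: [K11]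
    occupies the last two row blocks, so [F1 *m x] is paired with [(dsubmx x, x3)] and not with
    [x]. *)
Lemma ctrl_add_form (x : 'cV_(n + n)) (x3 : 'cV_n) (y1 y2 : 'cV_l) (w : 'cV_mp) :
  let z := col_mx (col_mx (col_mx x x3) (col_mx y1 y2)) w in
  dot z (perf_form gamma (syn_sys G v X2 Y2 ctrl_add) 1%:M 1%:M *m z) =
  dot z (perf_form gamma (syn_sys G v X2 Y2 c) 1%:M 1%:M *m z)
  + 2 * dot (col_mx (dsubmx x) x3) (F1 *m x) + 2 * dot y2 (F2 *m y1).
Proof.
move=> z.
have e11 : pA11 (syn_sys G v X2 Y2 ctrl_add) =
    pA11 (syn_sys G v X2 Y2 c) + row_cast (block_mx 0 0 F1 0).
  rewrite /syn_sys [LHS]/= [X in X + _]/=. rewrite !syn_blockE !block_mxKul. rewrite /synK11 /=.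
  set A := block_mx _ _ _ _; set B := block_mx _ _ _ _; set C := block_mx 0 _ _ _.
  suff -> : A = B + C.
    exact: row_castD.
  rewrite /A /B /C add_block_mx !addr0; congr (block_mx _ _ _ _).
  set a := projU _; set b := projU _; set d := projU _; set e := _ *m synC1e G.
  move: a b d e => a b d e.
  by apply/matrixP => i j; rewrite !mxE; ring.
have e22 : pA22 (syn_sys G v X2 Y2 ctrl_add) =
    pA22 (syn_sys G v X2 Y2 c) + block_mx 0 0 F2 0.
  by rewrite /syn_sys /= !syn_blockE !block_mxKul add_block_mx !addr0.
have e12 : pA12 (syn_sys G v X2 Y2 ctrl_add) = pA12 (syn_sys G v X2 Y2 c).
  by rewrite /syn_sys /= !syn_blockE !block_mxKul.
have e21 : pA21 (syn_sys G v X2 Y2 ctrl_add) = pA21 (syn_sys G v X2 Y2 c).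
  by rewrite /syn_sys /= !syn_blockE !block_mxKul.
have [b1 b2] : pB1 (syn_sys G v X2 Y2 ctrl_add) = pB1 (syn_sys G v X2 Y2 c) /\
    pB2 (syn_sys G v X2 Y2 ctrl_add) = pB2 (syn_sys G v X2 Y2 c).
  by rewrite /syn_sys /= !syn_blockE !block_mxKur.
have [d1 d2] : pC1 (syn_sys G v X2 Y2 ctrl_add) = pC1 (syn_sys G v X2 Y2 c) /\
    pC2 (syn_sys G v X2 Y2 ctrl_add) = pC2 (syn_sys G v X2 Y2 c).
  by split; rewrite /syn_sys /= !syn_blockE !block_mxKdl.
have d3 : pD (syn_sys G v X2 Y2 ctrl_add) = pD (syn_sys G v X2 Y2 c).
  by rewrite /syn_sys /= !syn_blockE !block_mxKdr.
move: (syn_sys G v X2 Y2 ctrl_add) (syn_sys G v X2 Y2 c) e11 e12 e21 e22 b1 b2 d1 d2 d3.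
move=> S' S e11 e12 e21 e22 b1 b2 d1 d2 d3.
rewrite {}/z !(perf_formE _ _ _ _ _ (trmx1 _ _) (trmx1 _ _)) e11 e12 e21 e22 b1 b2 d1 d2 d3.
rewrite !mul1mx.
rewrite (mulmxDl (pA11 S)) (mulmxDl (pA22 S)) row_cast_mul !mul_block_col !mul0mx !addr0.
have er : dot (col_mx x x3) (row_cast (col_mx 0 (F1 *m x))) = dot (col_mx (dsubmx x) x3) (F1 *m x).
  rewrite -{1}[F1 *m x]vsubmxK row_cast_col -{1}[x]vsubmxK !dot_col dot0r add0r.
  by rewrite -[F1 *m x in RHS]vsubmxK dot_col.
have el : dot (col_mx y1 y2) (col_mx 0 (F2 *m y1)) = dot y2 (F2 *m y1).
  by rewrite dot_col dot0r add0r.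
rewrite !(dotDr (col_mx x x3)) !(dotDr (col_mx y1 y2)) er el.
by ring.
Qed.

End ControllerPerturbation.

(** * Strict synthesis inequalities from a given controller *)

Section Necessity.
Variable R : realType.
Variables (n1 n2 r s mp kp m1 m2 k1 k2 c1 c2 lc : nat).
Notation n := (n1 + n2)%N.
Notation m := (m1 + m2)%N.
Notation k := (k1 + k2)%N.
Notation l := (r + s)%N.
Variables (V : set 'M[R]_(r, s)) (G : plant R n l l mp kp m k) (gamma : R).
Variable (K : controller R r s (c1 + c2) lc lc m k).
Variables (X : 'M[R]_(n + (c1 + c2))) (P : 'M[R]_(l + lc)).
Hypotheses (lB1 : lower_btri (gB1 G)) (lC1 : lower_btri (gC1 G)) (zB2 : last_cols0 (gB2 G)).
Hypotheses (V0 : V 0) (HK : classK2 K) (pX : posdef X) (HP : classP V (cDelta K) P).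
Hypothesis hcl : negdef (perf_form gamma (closed_loop G K) X P).

Let v := facv X.
Let U1 := facU X.
Let Z1 := facZ X.
Let X2 := ulsubmx P.
Let Y2 := ulsubmx (invmx P).
Let U2 := ursubmx P.
Let Z2 := dlsubmx (invmx P).
Notation X1 := (lyX1 v).
Notation Y1 := (lyY1 v).

(** Expressing [trK] through the images [trL] and [trM] exposes the combination whose blocks
    [ur_synK11] and [rs_synK21] compute. *)
Lemma trKE p pc q qc p' q' (A : 'M[R]_(p, q)) (B : 'M[R]_(p, m)) (C : 'M[R]_(k, q))
    (X' : 'M[R]_(p, p')) (Y : 'M[R]_(q, q')) (U : 'M[R]_(p', pc)) (Z : 'M[R]_(qc, q')) Ac Bc Cc Dc :
  trK A B C X' Y U Z Ac Bc Cc Dc = X'^T *m A *m Y + U *m Ac *m Z +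
    (X'^T *m B *m trM C Y Z Cc Dc + trL B X' U Bc Dc *m C *m Y - X'^T *m B *m Dc *m C *m Y).
Proof.
rewrite /trK /trM /trL !(mulmxDl, mulmxDr) !mulmxA.
move: (X'^T *m A *m Y) (U *m Ac *m Z) (X'^T *m B *m Cc *m Z) (U *m Bc *m C *m Y)
  (X'^T *m B *m Dc *m C *m Y) => a b c d e.
by apply/matrixP => i j; rewrite !mxE; ring.
Qed.

Let L1 := trL (gB1 G) X1 U1 (cB1 K) (cD K).
Let M1 := trM (gC1 G) Y1 Z1 (cC1 K) (cD K).
Let L2 := trL (gB2 G) X2 U2 (cB2 K) (cD K).
Let vL := L1 - projU (synB1e G *m cD K).
Let vM := M1 - projU (cD K *m synC1e G).

Definition ctrl0 : ctrl_vars R n l m k := {|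
  vK11 := trK (gA11 G) (gB1 G) (gC1 G) X1 Y1 U1 Z1 (cA11 K) (cB1 K) (cC1 K) (cD K)
    - (projU (X1^T *m gA11 G *m Y1) + projU (synB1e G *m vM) + projU (vL *m synC1e G)
       - synB1e G *m cD K *m synC1e G);
  vK12 := trK (gA12 G) (gB1 G) (gC2 G) X1 Y2 U1 Z2 (cA12 K) (cB1 K) (cC2 K) (cD K);
  vL1 := vL;
  vK21 := trK (gA21 G) (gB2 G) (gC1 G) X2 Y1 U2 Z1 (cA21 K) (cB2 K) (cC1 K) (cD K)
    - (projR (X2^T *m gA21 G *m Y1) + projR (L2 *m synC1e G));
  vK22 := trK (gA22 G) (gB2 G) (gC2 G) X2 Y2 U2 Z2 (cA22 K) (cB2 K) (cC2 K) (cD K);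
  vL2 := L2;
  vM1 := vM;
  vM2 := trM (gC2 G) Y2 Z2 (cC2 K) (cD K);
  vN := cD K |}.

Let synL1_0 : synL1 G ctrl0 = L1.
Proof. by rewrite /synL1 /= /vL subrK. Qed.

Let synM1_0 : synM1 G ctrl0 = M1.
Proof. by rewrite /synM1 /= /vM subrK. Qed.

Lemma ctrl0_same : same_ctrl G K v X2 Y2 ctrl0 U1 Z1 U2 Z2.
Proof.
split=> //.
- rewrite /synK11 /ctrl0 /=; move: (trK _ _ _ _ _ _ _ _ _ _ _) => t.
  set a := projU _; set b := projU _; set d := projU _; set e := synB1e G *m cD K *m _.
  by move: a b d e => a b d e; apply/matrixP => i j; rewrite !mxE; ring.
- by rewrite /synK21 /ctrl0 /= -addrA subrK.
Qed.

(** As [U1], [Z1] and the controller are triangular, [U1 Ac Z1] does not reach the upper right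
    block; all that lies there is the prescribed part which [ctrl0] subtracts. *)
Lemma ctrl0_structured : ctrl_structured ctrl0.
Proof.
case: HK => -[lA lB lC lD] zA zB.
have lU := facU_lower pX; have lZ := facZ_lower X.
have lL : lower_btri (vL1 ctrl0).
  apply/projU_lower; rewrite /L1 /trL ursubmxD ur_X1B1_lower //.
  by rewrite (lower_btri_mul lU lB) add0r.
have lM : lower_btri (vM1 ctrl0).
  apply/projU_lower; rewrite /M1 /trM ursubmxD ur_C1Y1_lower //.
  by rewrite (lower_btri_mul lC lZ) add0r.
have zL : last_cols0 (vL2 ctrl0).
  by rewrite /last_cols0 /= /L2 /trL rsubmxD rs_B2 // lD mulmx0 addr0 -mulmx_rsub zB mulmx0.
split; first split => //.
- rewrite /lower_btri /ctrl0 /= trKE -/M1 -/L1 -synL1_0 -synM1_0.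
  rewrite ursubmxD ursubmxD ursubmxD ur_synK11 //.
  rewrite (lower_btri_mul (lower_btri_mul lU lA) lZ) ursubmxN !ursubmxD ursubmxN !block_mxKur /=.
  set a := ursubmx _; set b := ursubmx _; set d := ursubmx _; set e := ursubmx _.
  by move: a b d e => a b d e; apply/matrixP => i j; rewrite !mxE; ring.
- rewrite /last_cols0 /ctrl0 /= trKE -/M1 -/L2 -synM1_0 rsubmxD rsubmxD rsubmxD.
  have -> : L2 = vL2 ctrl0 by [].
  rewrite (rs_synK21 _ lC1) //= rsubmxN rsubmxD !row_mxKr.
  have -> : rsubmx (U2 *m cA21 K *m Z1) = 0.
    rewrite -mulmx_rsub -mulmxA -[cA21 K]hsubmxK zA -[rsubmx Z1]vsubmxK usub_rsub lZ.
    by rewrite mul_row_col mulmx0 mul0mx addr0 mulmx0.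
  by rewrite addr0 subrr.
- exact: zL.
Qed.

(* Let [a = T1 x1], [b = T2 x2] and [d = a + b + x3], a component of the congruence,
   so that the form is at most [- c |d|^2]. Adding [e *: F1] to [K11] adds
   [2 e (a . b + x3 . (a + b))] to it, and for [e = c / 2] the sum is
   [- c / 2 (|a|^2 + |b|^2 + |x3|^2 + |d|^2)]. *)
Let F1 : 'M[R]_(n + n) := block_mx ((lyT2 v)^T *m vT1 v) 0 (vT1 v) (lyT2 v).

(** The second channel is treated likewise: with [g = Y2 y1], the term [e *: Y2] adds [2 e g . y2],
    which is absorbed by [- c |g + y2|^2] at [e = c / 2]. *)
Definition ctrl_eps (e : R) : ctrl_vars R n l m k := ctrl_add ctrl0 (e *: F1) (e *: Y2).

Lemma ctrl_eps_structured e : ctrl_structured (ctrl_eps e).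
Proof.
have [[lK lL lM lN] cK cL] := ctrl0_structured.
split=> //; split=> //.
by rewrite /lower_btri /= ursubmxD lK add0r scale_block_mx block_mxKur scaler0.
Qed.

Lemma necessity_lmi :
  exists e, negdef (perf_form gamma (syn_sys G v X2 Y2 (ctrl_eps e)) 1%:M 1%:M).
Proof.
have sX := posdef_sym pX; have sP : P^T = P by case: HP.
have [c c0 Hc] := posdef_coercive ((posdefN _).1 hcl).
exists (c / 2); split; first by apply: perf_form_tr; rewrite trmx1.
move=> z z0; rewrite qformE.
have [x1 [x2 [x3 [y1 [y2 [w ez]]]]]] : exists x1 x2 x3 y1 y2 w,
    z = col_mx (col_mx (col_mx (col_mx x1 x2) x3) (col_mx y1 y2)) w.
  exists (usubmx (usubmx (usubmx (usubmx z)))), (dsubmx (usubmx (usubmx (usubmx z)))),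
    (dsubmx (usubmx (usubmx z))), (usubmx (dsubmx (usubmx z))), (dsubmx (dsubmx (usubmx z))),
    (dsubmx z).
  by rewrite !vsubmxK.
rewrite {z}ez in z0 *.
rewrite (ctrl_add_form G v gamma X2 Y2 ctrl0).
rewrite (syn_sys_form gamma sX sP (fac_cast pX) (mult_cast V0 HP) ctrl0_same).
rewrite -/v -/U1 -/Z1 -/X2 -/Y2 -/U2 -/Z2.
set zz := col_mx _ w.
have := Hc zz; rewrite mulNmx dotNr.
have -> : zz = col_mx (col_mx (col_mx (vT1 v *m x1 + lyT2 v *m x2 + x3) (Z1 *m col_mx x1 x2))
     (col_mx (Y2 *m y1 + y2) (Z2 *m y1))) w.
  by rewrite /zz /lyY1 !mul_block_col mul_row_col !mul1mx !mul0mx !addr0.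
rewrite col_mxKd -!scalemxAl !dotZr /F1 mul_block_col mul0mx addr0 -mulmxA.
move: (dot _ (perf_form _ _ _ _ *m _)) => f.
rewrite !dot_col -dot_mull.
have := dot_ge0 (Z1 *m col_mx x1 x2); have := dot_ge0 (Z2 *m y1).
move: (dot (Z1 *m _) _) (dot (Z2 *m _) _) => d1 d2.
(* Invertibility of [T1], [T2] and [Y2] is what makes the sum of squares below vanish only for
   [z = 0]; the components through [Z1] and [Z2] enter merely as nonnegative terms. *)
have ux1 : vT1 v *m x1 = 0 -> x1 = 0 by apply/unitmx_inj/facT1_unit.
have ux2 : lyT2 v *m x2 = 0 -> x2 = 0 by apply/unitmx_inj/facT2_unit.
have uy : Y2 *m y1 = 0 -> y1 = 0 by apply/unitmx_inj/(mult_dual_unit V0 HP).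
move: (vT1 v *m x1) (lyT2 v *m x2) (Y2 *m y1) ux1 ux2 uy => a b g ua ub ug d10 d20.
have : 0 < dot a a + dot b b + dot x3 x3 + dot g g + dot y2 y2 + dot w w.
  rewrite lt0r; apply/andP; split; last by do ![apply: addr_ge0 | apply: dot_ge0].
  apply: contraNneq z0 => s0.
  have := dot_ge0 a; have := dot_ge0 b; have := dot_ge0 x3; have := dot_ge0 g.
  have := dot_ge0 y2; have := dot_ge0 w => *.
  have /dot_eq0/ua-> : dot a a = 0 by lra.
  have /dot_eq0/ub-> : dot b b = 0 by lra.
  have /dot_eq0/ug-> : dot g g = 0 by lra.
  have /dot_eq0-> : dot x3 x3 = 0 by lra.
  have /dot_eq0-> : dot y2 y2 = 0 by lra.
  have /dot_eq0-> : dot w w = 0 by lra.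
  by rewrite !col_mx0.
have := dot_ge0 (a + b + x3); have := dot_ge0 (g + y2); have := dot_ge0 w.
rewrite !dotS (dotC b a) (dotC x3 a) (dotC x3 b) (dotC y2 g).
move: (dot a a) (dot b b) (dot x3 x3) (dot g g) (dot y2 y2) (dot w w)
  (dot a b) (dot a x3) (dot b x3) (dot g y2).
move=> aa bb xx gg yy ww ab ax bx gy h1 h2 h3 h4 h5.
(* Twice the gap to be shown, after the cross terms have turned half of each expanded square into
   separate squares. *)
suff : 0 < c * (2 * (d2 + d1) + (aa + bb + xx + gg + yy + ww) + ww
   + (aa + bb + xx + 2 * ab + 2 * ax + 2 * bx) + (gg + 2 * gy + yy)) by lra.
by rewrite mulr_gt0 //; lra.
Qed.

Lemma necessity : exists (v : lyap_vars R n1 n2) (X2 Y2 : 'M[R]_l) (c : ctrl_vars R n l m k),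
  [/\ lyap_sym v, classPp V X2, classPd V Y2 & ctrl_structured c]
  /\ negdef (perf_form gamma (syn_sys G v X2 Y2 c) 1%:M 1%:M) /\ posdef (lyXX v).
Proof.
have [e He] := necessity_lmi.
have [sS sT sS2 sT2] := facv_sym pX.
have v0 : lyap_shift v 0 = v.
  have e0 : 0%:M = 0 :> 'M[R]_n by exact: raddf0.
  by rewrite /lyap_shift e0 !addr0; case: (v).
have [d d0 Hd] : exists2 d : R, 0 < d & forall t, `|t| < d ->
    negdef (perf_form gamma (syn_sys G (lyap_shift v t) X2 Y2 (ctrl_eps e)) 1%:M 1%:M).
  apply: (@perf_form_perturb _ _ _ _ _ gamma
    (fun t => syn_sys G (lyap_shift v t) X2 Y2 (ctrl_eps e))).
  - by rewrite trmx1.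
  - by rewrite trmx1.
  - exact: aff_syn_shift.
  - by rewrite v0.
have t0 : 0 < d / 2 by lra.
exists (lyap_shift v (d / 2)), X2, Y2, (ctrl_eps e); split; first split.
- by split => //=; rewrite [LHS]linearD /= tr_scalar_mx ?sS ?sT.
- exact: mult_primal V0 HP.
- exact: mult_dual V0 HP.
- exact: ctrl_eps_structured.
split; first by apply: Hd; rewrite gtr0_norm //; lra.
split.
  have e0 : (lyXX v)^T = lyXX v by rewrite lyXX_fac // !trmx_mul trmxK mulmxA posdef_sym.
  rewrite lyXX_shift [LHS]linearD /= e0 [X in _ + X = _]linearZ /=; congr (_ + _ *: _).
  by rewrite !tr_block_mx !trmx1 !trmx0.
move=> z z0; rewrite qformE -[z]vsubmxK -[dsubmx z]vsubmxK in z0 *.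
move: (usubmx z) (usubmx (dsubmx z)) (dsubmx (dsubmx z)) z0 => x y w z0.
rewrite lyXX_shift mulmxDl dotDr facXX_form // -scalemxAl dotZr.
set T := block_mx (lyY1 v) _ _ _.
rewrite (mul_block_col 1%:M 0 0 _ x) (mul_block_col 0 0 0 1%:M y).
rewrite !mul0mx !addr0 !add0r !mul1mx !dot_col dot0r add0r.
have := posdef_ge0 (T *m col_mx (col_mx x y) w) pX.
rewrite le_eqVlt => /predU1P[q0|q0]; last first.
  by apply: ltr_wpDr q0; rewrite mulr_ge0 // ?addr_ge0 ?dot_ge0 // ltW.
rewrite -q0 add0r mulr_gt0 // lt0r addr_ge0 ?dot_ge0 // andbT.
apply: contraNneq z0 => s0.
have := dot_ge0 x; have := dot_ge0 w => h1 h2.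
have /dot_eq0 x0 : dot x x = 0 by lra.
have /dot_eq0 w0 : dot w w = 0 by lra.
(* The shift adds a multiple of [|x|^2 + |w|^2] to a semidefinite form. On its null vectors
   [x = w = 0], and [T] then reduces to [T2] acting on [y], which is injective. *)
have : T *m col_mx (col_mx x y) w = 0.
  by apply/eqP; apply: contraT => /(posdef_gt0 pX); rewrite -q0 ltxx.
rewrite /T x0 w0 mul_block_col /lyY1 mul_row_col !mulmx0 add0r !addr0.
rewrite -(col_mx0 _ n (c1 + c2) 1) => /eq_col_mx[] /(unitmx_inj (facT2_unit pX)) -> _.
by rewrite !col_mx0.
Qed.

End Necessity.

(** * Rescaling and the equivalence *)

Section Sufficiency.
Variable R : realType.
Variables (n1 n2 r s mp kp m1 m2 k1 k2 : nat).
Notation n := (n1 + n2)%N.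
Notation m := (m1 + m2)%N.
Notation k := (k1 + k2)%N.
Notation l := (r + s)%N.
Variables (V : set 'M[R]_(r, s)) (G : plant R n l l mp kp m k) (gamma : R).

(** [classPp] is a cone and the inequality is strict, so [X2] may be replaced by [(1 + t) X2] for
    small [t], chosen so that [1 - (1 + t) X2 Y2] is invertible. *)
Lemma sufficiency (v : lyap_vars R n1 n2) (X2 Y2 : 'M[R]_l) (c : ctrl_vars R n l m k) :
  lower_btri (gB1 G) -> lower_btri (gC1 G) -> last_cols0 (gB2 G) -> V 0 ->
  lyap_sym v -> classPp V X2 -> classPd V Y2 -> ctrl_structured c ->
  negdef (perf_form gamma (syn_sys G v X2 Y2 c) 1%:M 1%:M) -> posdef (lyXX v) ->
  exists (K : controller R r s (n + n) l l m k) X P,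
    [/\ classK2 K, affine_on V (cDelta K), posdef X, classP V (cDelta K) P
      & negdef (perf_form gamma (closed_loop G K) X P)].
Proof.
move=> lB1 lC1 zB2 V0 sv pX2 pY2 hc hlmi pXX.
have [e e0 He] : exists2 e : R, 0 < e & forall t, `|t| < e ->
    negdef (perf_form gamma (syn_sys G v ((1 + t) *: X2) Y2 c) 1%:M 1%:M).
  apply: (@perf_form_perturb _ _ _ _ _ gamma (fun t => syn_sys G v ((1 + t) *: X2) Y2 c)).
  - by rewrite trmx1.
  - by rewrite trmx1.
  - exact: aff_syn_scale.
  - by rewrite addr0 scale1r.
have [t [/He hlmi' t0]] := scale_unitmx (X2 *m Y2) e0.
rewrite scalemxAl => uU2; have pX2' := classPp_scale V0 t0 pX2.
exists (recK G v ((1 + t) *: X2) Y2 c), (recX v), (recP ((1 + t) *: X2) Y2).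
split; [exact: rec_class | exact: rec_affine | exact: rec_posdef | exact: rec_classP |].
exact: (rec_lmi (V := V)).
Qed.

End Sufficiency.

Theorem theorem7 (R : realType) (n1 n2 m1 m2 k1 k2 r s mp kp : nat)
    (N : nat) (Deltas : 'I_N -> 'M[R]_(r, s))
    (V0 : conv_hull Deltas 0)
    (G : plant R (n1 + n2) r s mp kp (m1 + m2) (k1 + k2)) (HG : classG2 G)
    (gamma : R) (gamma_gt0 : 0 < gamma) :
  let V := conv_hull Deltas in
  let statement_i :=
    exists (nc1 nc2 lc : nat)
      (K : controller R r s (nc1 + nc2) lc lc (m1 + m2) (k1 + k2))
      (X1 : 'M[R]_((n1 + n2) + (nc1 + nc2))) (P : 'M[R]_((r + s) + lc)),
      [/\ classK2 K, posdef X1, classP V (cDelta K) P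
        & analysis_lmi gamma G K X1 P] in
  let statement_ii :=
    exists (v : lyap_vars R n1 n2) (X2 Y2 : 'M[R]_(r + s))
      (c : ctrl_vars R (n1 + n2) (r + s) (m1 + m2) (k1 + k2)),
      [/\ lyap_sym v, classPp V X2, classPd V Y2 & ctrl_structured c]
      /\ synthesis_lmi gamma G v X2 Y2 c /\ posdef (lyXX v) in
  (statement_i <-> statement_ii)
  /\ (statement_ii ->
      exists (nc1 nc2 lc : nat)
        (K : controller R r s (nc1 + nc2) lc lc (m1 + m2) (k1 + k2))
        (X1 : 'M[R]_((n1 + n2) + (nc1 + nc2))) (P : 'M[R]_((r + s) + lc)),
        [/\ classK2 K, affine_on V (cDelta K), posdef X1,
            classP V (cDelta K) P & analysis_lmi gamma G K X1 P]
        /\ (nc1 + nc2 <= 2 * (n1 + n2))%N /\ (lc <= r + s)%N).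
Proof.
move=> V i ii; have [_ lB1 lC1 _ zB2] := HG.
have zB2' : last_cols0 (gB2 (lift_plant G)).
  have e : gB2 G = row_mx (lsubmx (gB2 G)) 0 by rewrite -{1}[gB2 G]hsubmxK zB2.
  rewrite /last_cols0 /= e scale_row_mx scaler0 -[X in col_mx X _]row_mx0.
  by rewrite -block_mxEv block_mxEh row_mxKr col_mx0.
have ii_i : ii -> exists (nc1 nc2 lc : nat)
    (K : controller R r s (nc1 + nc2) lc lc (m1 + m2) (k1 + k2))
    (X1 : 'M[R]_((n1 + n2) + (nc1 + nc2))) (P : 'M[R]_((r + s) + lc)),
    [/\ classK2 K, affine_on V (cDelta K), posdef X1,
        classP V (cDelta K) P & analysis_lmi gamma G K X1 P]
    /\ (nc1 + nc2 <= 2 * (n1 + n2))%N /\ (lc <= r + s)%N.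
  move=> [v [X2 [Y2 [c [[sv pX2 pY2 hc] [hlmi pXX]]]]]].
  have [K [X [P H]]] := sufficiency (G := lift_plant G) lB1 lC1 zB2' V0 sv pX2 pY2 hc hlmi pXX.
  exists (n1 + n2)%N, (n1 + n2)%N, (r + s)%N, K, X, P.
  by split => //; rewrite mul2n addnn !leqnn.
split=> //; split.
  move=> [c1 [c2 [lc [K [X [P [HK pX HP hcl]]]]]]].
  exact: (necessity (G := lift_plant G) lB1 lC1 zB2' V0 HK pX HP hcl).
move=> /ii_i[c1 [c2 [lc [K [X [P [[HK _ pX HP hcl] _]]]]]]].
by exists c1, c2, lc, K, X, P.
Qed.
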